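(* Let $(a,b)\in S$ and $L=L_{a,b}$. The set of kneading sequences of $L$, the folding pattern of $L$, and the folding tree of $L$ are equivalent. That is, given one of them, we can recover the other two.
   Context: Setting. $S$ is the set of $(a,b)\in\mathbb R^2$ with $b>0$, $a\sqrt2>b+2$, $b<\frac{a^2-1}{2a+1}$, $2a+b<4$. For $(a,b)\in S$, $L=L_{a,b}:\mathbb R^2\to\mathbb R^2$, $L(x,y)=(1+y-a|x|,\,bx)$, a homeomorphism. $X=(\frac1{1+a-b},\frac b{1+a-b})$ is a hyperbolic fixed point. $R=\{T: L^{-n}(T)\to X \text{ as } n\to\infty\}$ is its unstable manifold; it is a broken line, the image of the real line under a continuous injective map, and is considered with the topology and arc length of the real line; $[A,B]\subset R$ denotes the arc of $R$ with endpoints $A,B$. $R^+$ is the half of $R$ starting at $X$ and going to the right; it first meets the horizontal axis at $Z=\bigl(\frac{2+a+\sqrt{a^2+4b}}{2(1+a-b)},0\bigr)$. $R^-$ is the other half. Order $R$ by $\triangleleft$ as the real line, with $R^-$ preceding $X$ and $R^+$ following $X$. $L|_R$ reverses this order. Write $L^n(P)=(P^n_x,P^n_y)$. Basic points and arcs. $G\in R$ is a gluing point if $G_x=0$ and $G^{-k}_x\ne0$ for all integers $k\ge1$. A turning point is $L(G)$ with $G$ gluing; a postturning point is $L^j(T)$ with $T$ turning, $j\ge1$. Basic points are the gluing, turning and postturning points. They form a discrete set, numbered $\{E_i: i\in\mathbb Z\}$ with $E_0=L^{-1}(Z)$ and $E_i\triangleleft E_{i+1}$ for all $i$ (so $E_1=Z$,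 and $X$ lies between $E_0$ and $E_1$). The arcs $[E_i,E_{i+1}]$ are the basic arcs. Kneading sequences. An itinerary of $P\in R$ is a sequence $\bar p=(p_n)_{n\in\mathbb Z}$ of symbols $+,-$ with $P^n_x\ge0$ whenever $p_n=+$ and $P^n_x\le0$ whenever $p_n=-$. If $P^n_x=0$ for some $n$, there is a smallest such $n$, call it $k$ (then $L^k(P)$ is a gluing point). If $l>k$ and $P^l_x=0$, then for all $Q\ne P$ close enough to $P$ in $R$ the numbers $Q^l_x$ are nonzero and have the same sign $s_l$; only itineraries with $p_l=s_l$ for all such $l>k$ are used. Thus each turning point $T$ has exactly two such itineraries, differing only at coordinate $-1$; the kneading sequence of $T$ is this pair, regarded as one bi-infinite sequence with the symbol $\pm$ at coordinate $-1$. The set of kneading sequences of $L$ is the set of the kneading sequences of all turning points. Folding pattern. It is the sequence obtained from $(\dots,E_{-2},E_{-1},E_0,E_1,E_2,\dots)$ by replacing $E_i$ with the symbol $G$ if $E_i$ is a gluing point and with the symbol $T$ if $E_i$ is a turning or postturning point, and inserting the symbol $X$ between the entries for $E_0$ and $E_1$ (the position of the fixed point). Folding tree. It is the directed graph whose vertices are the basic arcs $[E_i,E_{i+1}]$ (denoted just by the number $i\in\mathbb Z$), with an arrow from $i$ to $j$ if and only if $L([E_i,E_{i+1}])\supset[E_j,E_{j+1}]$. Except for the vertex $0$ and the arrows beginning at it, it is a subtree of the full binary tree. It is regarded as embedded in the plane and divided into levels: $0$ is at level $0$, $-1$ is at level $1$, and $i$ is at level $n+1$ if the path from $-1$ to $i$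 has $n$ arrows; starting with level 1, negative numbers are at odd levels and positive numbers at even levels, and at each level vertices are ordered from left to right with increasing absolute value. *)

(* Defs.v *)
From HB Require Import structures.
From mathcomp Require Import all_boot all_order all_algebra.
From mathcomp Require Import all_classical all_reals all_analysis.
Import Order.TTheory GRing.Theory Num.Theory.
Import numFieldNormedType.Exports.

Set Implicit Arguments.
Unset Strict Implicit.
Unset Printing Implicit Defensive.

Local Open Scope classical_set_scope.
Local Open Scope ring_scope.

Inductive sign := Plus | Minus.

(* Symbols of kneading sequences; [Both] is the symbol ±. *)
Inductive ksymbol := Only of sign | Both.

Inductive fsymbol := FG | FT | FX.

(* A directed graph with vertex set int: [g i j] is an arrow from i to j. *)
Definition digraph := int -> int -> Prop.

Section Lozi.
Context {R : realType}.
Implicit Types (a b : R) (P Q A B : R * R) (gam : R -> R * R)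
  (E : int -> R * R).

Definition param_region a b : Prop :=
  [/\ 0 < b, b + 2 < a * Num.sqrt 2, b < (a ^+ 2 - 1) / (2 * a + 1)
    & 2 * a + b < 4].

Definition lozi a b P : R * R := (1 + P.2 - a * `|P.1|, b * P.1).

Definition lozi_inv a b P : R * R :=
  (P.2 / b, P.1 - 1 + a * `|P.2 / b|).

Lemma loziK a b : b != 0 -> cancel (lozi a b) (lozi_inv a b).
Proof.
move=> b0 [x y]; rewrite /lozi /lozi_inv /= mulrC mulKf //; congr pair.
by rewrite addrAC subrK addrAC subrr add0r.
Qed.

Lemma lozi_invK a b : b != 0 -> cancel (lozi_inv a b) (lozi a b).
Proof.
move=> b0 [x y]; rewrite /lozi /lozi_inv /=; congr pair.
  by rewrite addrA addrK addrC subrK.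
by rewrite mulrC divfK.
Qed.

(* L^n for n in Z *)
Definition lozi_iter a b (n : int) P : R * R :=
  match n with
  | Posz k => iter k (lozi a b) P
  | Negz k => iter k.+1 (lozi_inv a b) P
  end.

Definition fixpt a b : R * R := (1 / (1 + a - b), b / (1 + a - b)).

Definition unstable a b : set (R * R) :=
  [set P | (fun n : nat => iter n (lozi_inv a b) P) @ \oo --> fixpt a b].

Definition ptZ a b : R * R :=
  ((2 + a + Num.sqrt (a ^+ 2 + 4 * b)) / (2 * (1 + a - b)), 0).

(* [gam] transports the order and the topology of the real line to the        *)
(* unstable manifold: positive parameters correspond to the half starting at  *)
(* the fixed point and going to the right. The last clause says that the Lozi *)
(* map reverses the order. The parametrization need not be by arc length:     *)
(* only the order and the topology matter below.                              *)
Definition unstable_param a b gam : Prop :=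
  [/\ continuous gam /\ injective gam,
      range gam = unstable a b,
      gam 0 = fixpt a b,
      \forall t \near 0^'+, (fixpt a b).1 < (gam t).1
    & forall s t s' t', gam s' = lozi a b (gam s) ->
        gam t' = lozi a b (gam t) -> s < t -> t' < s'].

Definition precedes gam P Q : Prop :=
  exists s t, [/\ gam s = P, gam t = Q & s < t].

Definition arc gam A B : set (R * R) :=
  [set P | exists s t u, [/\ gam s = A, gam t = B, gam u = P
                           & Num.min s t <= u <= Num.max s t]].

Definition gluing a b P : Prop :=
  [/\ unstable a b P, P.1 = 0
    & forall k : nat, (0 < k)%N -> (lozi_iter a b (- k%:Z) P).1 <> 0].

Definition turning a b P : Prop :=
  exists2 G, gluing a b G & P = lozi a b G.

Definition postturning a b P : Prop :=
  exists2 T, turning a b T &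
    exists2 j : nat, (0 < j)%N & P = iter j (lozi a b) T.

Definition basic a b P : Prop :=
  [\/ gluing a b P, turning a b P | postturning a b P].

Definition basic_numbering a b gam E : Prop :=
  [/\ range E = basic a b,
      E 0 = lozi_inv a b (ptZ a b)
    & forall i : int, precedes gam (E i) (E (i + 1))].

Definition itinerary a b P (p : int -> sign) : Prop :=
  forall n : int, (p n = Plus -> 0 <= (lozi_iter a b n P).1) /\
                  (p n = Minus -> (lozi_iter a b n P).1 <= 0).

Definition has_sign (s : sign) (x : R) : Prop :=
  match s with Plus => 0 < x | Minus => x < 0 end.

(* The itineraries in use: if k is the least time at which the orbit of P     *)
(* meets the vertical axis, then at every later such time l the symbol is the *)
(* sign of the abscissa of L^l(Q) for Q <> P close to P along the unstable    *)
(* manifold.                                                                  *)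
Definition admissible a b gam P (p : int -> sign) : Prop :=
  itinerary a b P p /\
  forall k l : int,
    (lozi_iter a b k P).1 = 0 ->
    (forall j : int, j < k -> (lozi_iter a b j P).1 <> 0) ->
    k < l -> (lozi_iter a b l P).1 = 0 ->
    forall t, gam t = P ->
      \forall u \near t^', has_sign (p l) (lozi_iter a b l (gam u)).1.

(* The two admissible itineraries p, q of T, as one sequence. *)
Definition kneading_of a b gam T (kn : int -> ksymbol) : Prop :=
  exists p q : int -> sign,
    [/\ forall r, admissible a b gam T r <-> r = p \/ r = q,
        p (-1) = Plus /\ q (-1) = Minus,
        forall n : int, n <> -1 -> p n = q n /\ kn n = Only (p n)
      & kn (-1) = Both].

Definition kneading_set a b gam : set (int -> ksymbol) :=
  [set kn | exists2 T, turning a b T & kneading_of a b gam T kn].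

(* The position of X is 0; E_i is at position i if i >= 1 and at position     *)
(* i - 1 if i <= 0.                                                           *)
Definition folding_pattern a b E (n : int) : fsymbol :=
  if n == 0 then FX
  else let i := if 0 < n then n else n + 1 in
       if `[< gluing a b (E i) >] then FG else FT.

Definition folding_tree a b gam E : digraph := fun i j =>
  arc gam (E j) (E (j + 1)) `<=` lozi a b @` arc gam (E i) (E (i + 1)).

End Lozi.

Fixpoint path_of_length (g : digraph) (n : nat) (i j : int) : Prop :=
  match n with
  | 0%N => i = j
  | m.+1 => exists2 k, g i k & path_of_length g m k j
  end.

Definition at_level (g : digraph) (n : nat) (i : int) : Prop :=
  match n with
  | 0%N => i = 0
  | m.+1 => path_of_length g m (-1) i
  end.

(* Equality of the drawings of two graphs, without vertex labels: vertices    *)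
(* are placed on levels, and at each level they are ordered from left to      *)
(* right with increasing absolute value.                                      *)
Definition same_plane_tree (g g' : digraph) : Prop :=
  exists phi : int -> int,
    [/\ bijective phi,
        forall i j, g i j <-> g' (phi i) (phi j),
        forall n i, at_level g n i <-> at_level g' n (phi i)
      & forall n i j, at_level g n i -> at_level g n j ->
          (`|i| < `|j|) = (`|phi i| < `|phi j|)].

(* Main.v *)
Require Import Defs.
From HB Require Import structures.
From mathcomp Require Import all_boot all_order all_algebra.
From mathcomp Require Import all_classical all_reals all_analysis.
From mathcomp Require Import zify ring lra.
Import Order.TTheory GRing.Theory Num.Theory.
Import numFieldNormedType.Exports.

(* The map L sends the basic points onto the turning and postturning ones,    *)
(* reversing the order, so t : Z -> Z defined by L(E_i) = E_(t i) is strictly *)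
(* decreasing, t 0 = 1 and t 1 = -1. The gluing indices are the complement of *)
(* the range of t, and the abscissa changes sign along the unstable manifold  *)
(* exactly at the gluing points. Hence the folding pattern determines t, the  *)
(* side of the vertical axis on which each basic arc lies, and from these the *)
(* kneading sequences and the folding tree (i -> j iff t (i+1) <= j < t i).   *)
(* Conversely, the depth of a vertex of the tree is monotone in its absolute  *)
(* value among the vertices of a given sign, so the drawing determines the    *)
(* labels, hence t. Finally, since L expands a cone of directions and the     *)
(* unstable manifold is bounded, its points are determined and ordered by     *)
(* their itineraries; as each basic point is an iterate of a gluing point,    *)
(* the kneading set determines the order of the basic points and their types. *)

Set Implicit Arguments.
Unset Strict Implicit.
Unset Printing Implicit Defensive.

Local Open Scope classical_set_scope.
Local Open Scope ring_scope.

(** * Combinatorics of the folding data *)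

Implicit Types i j : int.

(** All three objects are read off one combinatorial system: the action [t] of the map on the
    indices of basic points, the set of gluing indices and a side for each basic arc
    ([system_code]). It remains to recover this system from each object.

    Pattern: [t] enumerates the non-gluing indices in decreasing order and the sides switch exactly
    at gluing indices, so the gluing set fixes everything ([folding_data_eq]). Tree: depth and
    left-to-right order together recover the labels, hence [t] ([same_plane_tree_code]). Kneading
    set: match gluing points with equal kneading sequences, and then their images. The order of
    itineraries depends on their symbols alone, so the matching is an increasing bijection of the
    integers; it fixes 0, since E_0 is the only gluing point with an all-plus past, so it is the
    identity ([kneading_codes_gl]).

    The geometric input is that every backward orbit enters the straight arc [E_0, Z]. From there,
    as long as their symbols agree, two points differ by a vector of an invariant, expanded cone
    ([in_cone_step]), while the whole manifold stays in an invariant triangle ([trapped_lozi]). This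
    gives [itin_lt_param] and [itinerary_inj]. The same cones show that the manifold crosses the
    vertical axis at gluing points and folds at their images ([arc_sign_gl], [arc_sign_ngl]). *)

Lemma int_updown_ind (P : int -> Prop) :
  P 0 -> (forall i, P i -> P (i + 1)) -> (forall i, P i -> P (i - 1)) ->
  forall i, P i.
Proof.
move=> P0 PS PP; case=> n.
  elim: n => [//|n IH]; have -> : Posz n.+1 = Posz n + 1 by lia.
  exact: PS.
elim: n => [|n IH].
  exact: (PP 0 P0).
by have -> : Negz n.+1 = Negz n - 1; [lia|exact: PP].
Qed.

Lemma increasing_bijection_id (phi : int -> int) :
  {homo phi : i j / i < j} -> (forall j, exists i, phi i = j) ->
  phi 0 = 0 -> forall i, phi i = i.
Proof.
move=> phi_lt phi_surj phi0.
have phi_le i j : i <= j -> phi i <= phi j.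
  by rewrite le_eqVlt => /predU1P[->//|/phi_lt/ltW].
have step i : phi (i + 1) = phi i + 1.
  have lt_i : phi i < phi (i + 1) by apply: phi_lt; lia.
  have [k phik] := phi_surj (phi i + 1).
  have [ki|ik] := leP k i; first by have := phi_le _ _ ki; lia.
  have : phi (i + 1) <= phi k by apply: phi_le; lia.
  lia.
elim/int_updown_ind => [//|i IH|i IH]; first by rewrite step IH.
by have := step (i - 1); rewrite subrK IH; lia.
Qed.

(** Resolving [Both] to [Plus] is harmless: the abscissa vanishes at that coordinate. *)
Definition symbol_sign (k : ksymbol) : sign :=
  if k is Only s then s else Plus.

(* The basic arc whose image contains the basic arc i. *)
Definition parent (t : int -> int) (i : int) : int :=
  xget 0 [set k | t (k + 1) <= i < t k].

(* [sg i] is the side of the vertical axis on which the basic arc i lies and *)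
(* [t] the action of the map on the basic points, so this is the kneading    *)
(* sequence of the image of the gluing point j.                              *)
Definition kneading_code (t : int -> int) (sg : int -> sign) (j n : int) :
    ksymbol :=
  match n with
  | Posz m => Only (sg (iter m.+1 t j))
  | Negz 0 => Both
  | Negz m.+1 => Only (sg (iter m.+1 (parent t) j))
  end.

(** Itinerary of the [m]-th image of the gluing point [j]; the kneading sequence belongs to the
    first image, hence the shift by [m - 1]. *)
Definition itinerary_code t sg (j : int) (m : nat) (n : int) : sign :=
  symbol_sign (kneading_code t sg j (n + m%:Z - 1)).

Definition pattern_code (gl : int -> Prop) (n : int) : fsymbol :=
  if n == 0 then FX
  else let i := if 0 < n then n else n + 1 in
       if `[< gl i >] then FG else FT.

Definition tree_code (t : int -> int) : digraph :=
  fun i j => t (i + 1) <= j < t i.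

(** The interface between geometry and combinatorics. The arcs [i - 1] and [i] meet at the basic
    point [i], so [fd_sg_gl] and [fd_sg_ngl] say where the manifold changes side. *)
Record folding_data (t : int -> int) (gl : int -> Prop) (sg : int -> sign) :
    Prop := FoldingData {
  fd_decr : forall i j : int, i < j -> t j < t i;
  fd_t0 : t 0 = 1;
  fd_t1 : t 1 = -1;
  fd_gl : forall i, gl i <-> forall j, t j <> i;
  fd_sg0 : sg 0 = Plus;
  fd_sg_gl : forall i, gl i -> sg i <> sg (i - 1);
  fd_sg_ngl : forall i, ~ gl i -> sg i = sg (i - 1)
}.

(* [A n false] means that at time n the point with itinerary p is to the left *)
(* of the one with itinerary q, and [A n true] that it is to its right.       *)
Definition itin_lt (p q : int -> sign) : Prop :=
  exists A : int -> bool -> Prop,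
  [/\ exists M : int, forall n : int, n <= M ->
        [/\ p n = Plus, q n = Plus & A n (odd `|n|%N)],
      forall n o, A n o -> p n = q n ->
        A (n + 1) (if p n is Plus then ~~ o else o)
    & forall n, (p n = Plus -> q n = Minus -> ~ A n false) /\
                (p n = Minus -> q n = Plus -> ~ A n true)].

(** Both witnesses start from the same parity and evolve by the same rule until the first coordinate
    where [p] and [q] differ. There they share an orientation, which one of the two final clauses
    forbids. *)
Lemma itin_lt_asym p q : p <> q -> itin_lt p q -> itin_lt q p -> False.
Proof.
move=> pq [A [[M MA] stepA lastA]] [B [[N NB] stepB lastB]].
have [n0 n0P] : exists n, p n <> q n.
  by apply/existsNP => pqE; apply: pq; apply/funext.
pose m : int := Num.min M N.
have mE (n : int) : n <= m -> [/\ p n = q n, A n (odd `|n|%N) & B n (odd `|n|%N)].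
  move=> nm; have [|-> -> ?] := MA n; first by rewrite (le_trans nm)// ge_min lexx.
  by have [|_ _ ?] := NB n; first by rewrite (le_trans nm)// ge_min lexx orbT.
have kex : exists k, `[< p (m + Posz k) <> q (m + Posz k) >].
  exists `|n0 - m|%N; apply/asboolP; suff -> : m + Posz `|n0 - m|%N = n0 by [].
  have [n0m|] := leP n0 m; last by lia.
  by have [] := mE n0 n0m.
case: (ex_minnP kex) => k /asboolP pqk kmin.
have [c [Ao Bo]] : exists c, A (m + Posz k) c /\ B (m + Posz k) c.
  have eqs (i : nat) : (i < k)%N -> p (m + Posz i) = q (m + Posz i).
    move=> ik; apply: contrapT => /asboolP/kmin; lia.
  elim: (k) eqs => [|i IH] eqs.
    by rewrite addr0; have [_ ? ?] := mE m (lexx _); exists (odd `|m|%N).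
  have [j ji|c [Ao Bo]] := IH; first by apply: eqs; lia.
  have pqi := eqs i (ltnSn i).
  have -> : m + Posz i.+1 = m + Posz i + 1 by lia.
  exists (if p (m + Posz i) is Plus then ~~ c else c); split; first exact: stepA.
  by rewrite pqi; apply: stepB.
have [A1 A2] := lastA (m + Posz k); have [B1 B2] := lastB (m + Posz k).
by move: pqk A1 A2 B1 B2; case: (p _); case: (q _) => // _ A1 A2 B1 B2;
  case: c Ao Bo => Ao Bo; [exact: B2|exact: A1|exact: A2|exact: B1].
Qed.

(** * Parents, levels and gluing origins *)

Section FoldingData.
Context {t : int -> int} {gl : int -> Prop} {sg : int -> sign}.
Hypothesis D : folding_data t gl sg.
Let t_lt := fd_decr D.
Let t0 := fd_t0 D.
Let t1 := fd_t1 D.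

Lemma fd_le i j : i <= j -> t j <= t i.
Proof. by rewrite le_eqVlt => /predU1P[->//|/t_lt/ltW]. Qed.

Lemma fd_lt_iff i j : (t j < t i) = (i < j).
Proof.
by apply/idP/idP => [|/t_lt//]; apply: contraTT; rewrite -!leNgt => /fd_le.
Qed.

Lemma fd_inj : injective t.
Proof.
move=> i j tij; have [/t_lt|/t_lt|//] := ltgtP i j; by rewrite tij ltxx.
Qed.

Lemma fd_gap i (n : nat) : t (i + n%:Z) <= t i - n%:Z.
Proof.
elim: n => [|n IH]; first by rewrite addr0 subr0.
have : t (i + n.+1%:Z) < t (i + n%:Z) by apply: t_lt; lia.
by lia.
Qed.

(** A strictly decreasing integer map drops by at least 1 per step, counted from [t 1 = -1]. With
    [fd_npos], [t] swaps the two sides of the fixed point without approaching it, which drives the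
    inductions below. *)
Lemma fd_pos i : 0 < i -> t i <= - i.
Proof.
move=> i0; have := fd_gap 1 `|i - 1|%N.
have -> : 1 + `|i - 1|%N%:Z = i by lia.
by rewrite t1; lia.
Qed.

Lemma fd_npos i : i <= 0 -> 1 - i <= t i.
Proof.
move=> i0; have := fd_gap i `|i|%N.
have -> : i + `|i|%N%:Z = 0 by lia.
by rewrite t0; lia.
Qed.

Lemma fd_ngl i : ~ gl i -> exists j, t j = i.
Proof.
by move=> ngl; apply: contrapT => /forallNP nt; apply/ngl/(fd_gl D).
Qed.

Lemma fd_gl0 : gl 0.
Proof.
apply/(fd_gl D) => j tj; have [/[dup] j0 /fd_pos|/[dup] j0 /fd_npos] := ltP 0 j; lia.
Qed.

(** The intervals [t (k + 1), t k) tile the integers, since [t] decreases and is unbounded both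
    ways. *)
Lemma parentP i : t (parent t i + 1) <= i < t (parent t i).
Proof.
rewrite /parent; case: xgetP => [k _ //|noP].
pose P (k : nat) := t (`|i|%N%:Z + 1 - k%:Z) > i.
have exP : exists k, P k.
  exists (2 * `|i| + 1)%N; rewrite /P.
  have -> : `|i|%N%:Z + 1 - (2 * `|i| + 1)%N%:Z = - `|i|%N%:Z by lia.
  have : - `|i|%N%:Z <= 0 by lia.
  by move/fd_npos; lia.
case: (ex_minnP exP) => k Pk kmin.
exfalso; apply: (noP (`|i|%N%:Z + 1 - k%:Z)) => /=; apply/andP; split=> //.
case: k Pk kmin => [|k] Pk kmin.
  by have := @fd_pos (`|i|%N%:Z + 1); move: Pk; rewrite /P subr0; lia.
rewrite leNgt; apply/negP => Pk'.
suff /kmin : P k by lia.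
by rewrite /P; move: Pk'; congr (_ < t _); lia.
Qed.

Lemma tree_code_parent i : tree_code t (parent t i) i.
Proof. exact: parentP. Qed.

Lemma tree_code_anti i i' (k k' : int) :
  tree_code t k i -> tree_code t k' i' -> i <= i' -> k' <= k.
Proof.
move=> /andP[ki _] /andP[_ k'i'] ii'; rewrite leNgt; apply/negP => kk'.
have : t k' <= t (k + 1) by apply: fd_le; lia.
lia.
Qed.

Lemma tree_code_inj i (k k' : int) : tree_code t k i -> tree_code t k' i -> k = k'.
Proof.
by move=> ki k'i; apply/eqP; rewrite eq_le (tree_code_anti ki k'i)//
  (tree_code_anti k'i ki).
Qed.

Lemma tree_code_pos i (k : int) : 0 < k -> tree_code t k i -> i < 0 /\ k < - i.
Proof. by move=> k0 /andP[_ ik]; have := fd_pos k0; lia. Qed.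

Lemma tree_code_neg i (k : int) : k < 0 -> tree_code t k i -> 0 < i /\ - k <= i.
Proof.
move=> k0 /andP[ki _].
have : 1 - (k + 1) <= t (k + 1) by apply: fd_npos; lia.
lia.
Qed.

Lemma tree_code0 i : tree_code t 0 i <-> i = 0 \/ i = -1.
Proof. by rewrite /tree_code add0r t0 t1; lia. Qed.

Lemma path_of_length_last (g : digraph) n i j :
  path_of_length g n.+1 i j <-> exists2 k, path_of_length g n i k & g k j.
Proof.
elim: n i j => [|n IH] i j.
  split=> [[k gik /= kj]|[k /= ik gkj]].
    by exists i => //; rewrite -kj.
  by exists j => //; rewrite ik.
split=> [[k gik /IH[l kl glj]]|[k [l gil lk] gkj]].
  by exists l => //; exists k.
by exists l => //; apply/IH; exists k.
Qed.

Lemma at_level_neg n i : at_level (tree_code t) n.+1 i ->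
  if odd n then 0 < i else i < 0.
Proof.
elim: n i => [|n IH] i; first by move=> /= <-.
move/path_of_length_last => [k /IH + ki] /=.
by case: (odd n) => /= k0; [have [] := tree_code_pos k0 ki
                           |have [] := tree_code_neg k0 ki].
Qed.

Lemma at_level_ex i : i <> 0 -> exists n, at_level (tree_code t) n.+1 i.
Proof.
(* This ranks nonzero vertices as -1, 1, -2, 2, ...; a nonzero parent has smaller rank than its
   child. *)
pose mu (i : int) := if 0 < i then (2 * `|i|)%N else (2 * `|i|).-1.
move: {2}(mu i) (leqnn (mu i)) => N; elim: N i => [|N IH] i.
  by rewrite /mu; case: ltP => i0 H i00; lia.
move=> iN i0; have ki := tree_code_parent i; set k := parent t i in ki.
have [kneg|kpos|k0] := ltgtP k 0.
- have [ipos ik] := tree_code_neg kneg ki.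
  have [||n nk] := IH k; [|by lia|].
    by move: iN; rewrite /mu ipos; case: ltP => ?; lia.
  by exists n.+1; apply/path_of_length_last; exists k.
- have [ineg ik] := tree_code_pos kpos ki.
  have [||n nk] := IH k; [|by lia|].
    by move: iN; rewrite /mu kpos; case: ltP => ?; lia.
  by exists n.+1; apply/path_of_length_last; exists k.
- by rewrite k0 in ki; case/tree_code0: ki => // ->; exists 0%N.
Qed.

(** Parents of vertices of one sign again have one sign (or are 0), and taking parents preserves the
    comparison of absolute values. So climb both branches together; the smaller vertex reaches -1 no
    later. *)
Lemma at_level_mono n n' i j :
  at_level (tree_code t) n.+1 i -> at_level (tree_code t) n'.+1 j ->
  (j <= i < 0) || (0 < i <= j) -> (n <= n')%N.
Proof.
elim: n' n i j => [|n' IH] n i j ni nj ij.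
  case: n ni => // n ni; move: (nj) => /= jE.
  move/path_of_length_last: ni => [k nk ki].
  have iE : i = -1 by lia.
  have k0 : k = 0 by apply: (@tree_code_inj i) => //; apply/tree_code0; right.
  by have := at_level_neg nk; rewrite k0; case: odd.
case: n ni => // n /path_of_length_last[k nk ki].
move/path_of_length_last: nj => [l nl lj].
rewrite ltnS; apply: (IH n k l nk nl).
have k0 : k <> 0 by have := at_level_neg nk; case: odd; lia.
have l0 : l <> 0 by have := at_level_neg nl; case: odd; lia.
case/orP: ij => /andP[H1 H2].
  have := tree_code_anti lj ki H1.
  have [kneg|kpos|//] := ltgtP k 0; last by lia.
  by have [] := tree_code_neg kneg ki; lia.
have := tree_code_anti ki lj H2.
have [kneg|kpos|//] := ltgtP k 0; first by lia.
by have [] := tree_code_pos kpos ki; lia.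
Qed.

Lemma gluing_origin i : exists m j, gl j /\ i = iter m t j.
Proof.
(* This ranks indices as 0, 1, -1, 2, -2, ...; a preimage under [t] has smaller rank. *)
pose mu (i : int) := if 0 < i then (2 * `|i|)%N else (2 * `|i|).+1.
move: {2}(mu i) (leqnn (mu i)) => N; elim: N i => [|N IH] i iN.
  by move: iN; rewrite /mu; case: ltP => i0; lia.
have [gli|ngli] := pselect (gl i); first by exists 0%N, i.
have [k tk] := fd_ngl ngli.
have [|m [j [glj kE]]] := IH k; last by exists m.+1, j; split=> //=; rewrite -kE.
move: iN; rewrite /mu -tk.
by have [/[dup] k0 /fd_pos|/[dup] k0 /fd_npos] := ltP 0 k; case: ltP; lia.
Qed.

Lemma gluing_origin_inj m n i j : gl i -> gl j -> iter m t i = iter n t j ->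
  m = n /\ i = j.
Proof.
move=> gi gj; elim: m n => [|m IH] [|n] //=.
- by move=> iE; have /(fd_gl D)/(_ (iter n t j)) := gi; rewrite -iE.
- by move=> jE; have /(fd_gl D)/(_ (iter m t i)) := gj; rewrite jE.
- by move=> /fd_inj/IH[-> ->].
Qed.

Lemma parent_iter0 m : iter m (parent t) 0 = 0.
Proof.
elim: m => //= m ->; apply: (@tree_code_inj 0); first exact: tree_code_parent.
by apply/tree_code0; left.
Qed.

(** The arc 0 contains the fixed point and is its own parent, so the past of E_0 never leaves it. *)
Lemma kneading_code0 n : n < -1 -> kneading_code t sg 0 n = Only Plus.
Proof.
by case: n => [//|[|n]] // _; rewrite /kneading_code parent_iter0 (fd_sg0 D).
Qed.

End FoldingData.


(** Both maps list the complement of the same set [gl] in decreasing order, so agreement at [i]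
    propagates to both neighbours; these are half of the inequalities, the others follow by
    symmetry. *)
Lemma folding_data_succ_le t t' gl sg sg' :
  folding_data t gl sg -> folding_data t' gl sg' ->
  forall i : int, t i = t' i ->
  t (i + 1) <= t' (i + 1) /\ t (i - 1) <= t' (i - 1).
Proof.
move=> D D' i tiE; split.
- have [j tj] : exists j, t' j = t (i + 1).
    by apply: (fd_ngl D') => /(fd_gl D)/(_ (i + 1)).
  rewrite -tj; apply: (fd_le D').
  have : t' j < t' i by rewrite tj -tiE; apply: (fd_decr D); lia.
  by rewrite (fd_lt_iff D'); lia.
- have [j tj] : exists j, t j = t' (i - 1).
    by apply: (fd_ngl D) => /(fd_gl D')/(_ (i - 1)).
  rewrite -tj; apply: (fd_le D).
  have : t i < t j by rewrite tj tiE; apply: (fd_decr D'); lia.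
  by rewrite (fd_lt_iff D); lia.
Qed.

Lemma folding_data_eq t t' gl sg sg' :
  folding_data t gl sg -> folding_data t' gl sg' -> t = t' /\ sg = sg'.
Proof.
move=> D D'; split; apply/funext; elim/int_updown_ind.
- by rewrite (fd_t0 D) (fd_t0 D').
- move=> i ti; apply/eqP; rewrite eq_le.
  have [-> _] := folding_data_succ_le D D' ti.
  by have [-> _] := folding_data_succ_le D' D (esym ti).
- move=> i ti; apply/eqP; rewrite eq_le.
  have [_ ->] := folding_data_succ_le D D' ti.
  by have [_ ->] := folding_data_succ_le D' D (esym ti).
- by rewrite (fd_sg0 D) (fd_sg0 D').
- move=> i; have [gi|gi] := pselect (gl (i + 1)).
    have := fd_sg_gl D gi; have := fd_sg_gl D' gi; rewrite addrK => A B sgi.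
    by move: A B; rewrite sgi; case: (sg' i); case: (sg _); case: (sg' _).
  by rewrite (fd_sg_ngl D gi) (fd_sg_ngl D' gi) addrK.
- move=> i; have [gi|gi] := pselect (gl i).
    have := fd_sg_gl D gi; have := fd_sg_gl D' gi => A B sgi.
    by move: A B; rewrite sgi; case: (sg' i); case: (sg _); case: (sg' _).
  by rewrite (fd_sg_ngl D gi) (fd_sg_ngl D' gi).
Qed.

Lemma pattern_code_inj gl gl' : pattern_code gl = pattern_code gl' -> gl = gl'.
Proof.
move=> glE; apply/funext => i; apply/propext.
have glE' n : pattern_code gl n = pattern_code gl' n by rewrite glE.
have [i0|i0] := leP i 0.
  have := glE' (i - 1); rewrite /pattern_code.
  have -> : (i - 1 == 0) = false by lia.
  have -> : (0 < i - 1) = false by lia.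
  by rewrite subrK; do 2![case: asboolP].
have := glE' i; rewrite /pattern_code i0.
have -> : (i == 0) = false by lia.
by do 2![case: asboolP].
Qed.

(** * Recovery of the labels from the drawing of the tree *)

Section PlaneTree.
Context {t t' : int -> int} {gl gl' : int -> Prop} {sg sg' : int -> sign}.
Hypotheses (D : folding_data t gl sg) (D' : folding_data t' gl' sg').

(** The largest child of [i] is [t i - 1]. *)
Lemma tree_code_inj_data : tree_code t = tree_code t' -> t = t'.
Proof.
have aux s s' : (forall i j : int, i < j -> s j < s i) ->
    tree_code s = tree_code s' -> forall i : int, s i <= s' i.
  move=> s_lt tE i; have : tree_code s i (s i - 1).
    by have : s (i + 1) < s i by [apply: s_lt; lia]; rewrite /tree_code; lia.
  by rewrite tE /tree_code; lia.
move=> tE; apply/funext => i; apply/eqP; rewrite eq_le.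
by rewrite (aux t t' (fd_decr D) tE) (aux t' t (fd_decr D') (esym tE)).
Qed.

(* Within each sign the depth of a vertex is monotone in its absolute value, *)
(* so the drawing determines the labels.                                      *)
Lemma same_plane_tree_code :
  same_plane_tree (tree_code t) (tree_code t') -> t = t'.
Proof.
move=> [phi [phi_bij phiT phiL phi_lt]].
have phi0 : phi 0 = 0 by case: (phiL 0%N 0) => + _; apply.
have phiL' n i : at_level (tree_code t) n.+1 i ->
    at_level (tree_code t') n.+1 (phi i) by move/phiL.
have phi_sign i : (i < 0 -> phi i < 0) /\ (0 < i -> 0 < phi i).
  have [->|/eqP/(at_level_ex D)[n ni]] := eqVneq i 0; first by rewrite phi0; lia.
  have := at_level_neg D ni; have := at_level_neg D' (phiL' _ _ ni).
  by case: (odd n); lia.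
(* On a common level this is the left-to-right order; on different levels, [at_level_mono] in the
   second tree excludes the opposite comparison. *)
have phi_abs i j : (j < i < 0) || (0 < i < j) -> (`|phi i| < `|phi j|)%R.
  move=> ij; have [|ni niP] := @at_level_ex _ _ _ D i; first by lia.
  have [|nj njP] := @at_level_ex _ _ _ D j; first by lia.
  have : (ni <= nj)%N by apply: (at_level_mono D niP njP); lia.
  rewrite leq_eqVlt => /predU1P[nE|lt_n].
    rewrite -(phi_lt ni.+1)//; [by lia|by rewrite nE].
  rewrite ltNge; apply/negP => le_ji.
  have le_level : (phi i <= phi j < 0) || (0 < phi j <= phi i) -> (nj <= ni)%N.
    by move=> phi_ij; have := at_level_mono D' (phiL' _ _ njP) (phiL' _ _ niP);
      apply.
  suff : (phi i <= phi j < 0) || (0 < phi j <= phi i) by move/le_level; lia.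
  by have := phi_sign i; have := phi_sign j; lia.
have phi_id : forall i, phi i = i.
  apply: increasing_bijection_id => //.
    move=> x y xy; have := phi_sign x; have := phi_sign y.
    have := phi_abs x y; have := phi_abs y x.
    have [xE|x0] := eqVneq x 0; first by rewrite xE phi0; lia.
    by have [yE|y0] := eqVneq y 0; [rewrite yE phi0|]; lia.
  by have [psi _ psiK] := phi_bij => j; exists (psi j).
apply: tree_code_inj_data; apply/funext => i; apply/funext => j.
by apply/propext; have := phiT i j; rewrite !phi_id.
Qed.

End PlaneTree.

(** What the expansion of the map contributes: itineraries separate and order the basic points, and
    an all-plus past singles out E_0, which anchors the numbering. *)
Record kneading_order (t : int -> int) (gl : int -> Prop) (sg : int -> sign) :
    Prop := KneadingOrder {
  ko_lt : forall i j m n, gl i -> gl j -> iter m t i < iter n t j ->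
    itinerary_code t sg i m <> itinerary_code t sg j n /\
    itin_lt (itinerary_code t sg i m) (itinerary_code t sg j n);
  ko_0 : forall i, gl i ->
    (forall n, n < -1 -> kneading_code t sg i n = Only Plus) -> i = 0
}.

Definition kneading_codes t (gl : int -> Prop) sg : set (int -> ksymbol) :=
  [set kn | exists2 i, gl i & kn = kneading_code t sg i].

Lemma kneading_code_inj t gl sg : folding_data t gl sg ->
  kneading_order t gl sg -> forall i j, gl i -> gl j ->
  kneading_code t sg i = kneading_code t sg j -> i = j.
Proof.
move=> D O i j gi gj ijE.
have itE : itinerary_code t sg i 0 = itinerary_code t sg j 0.
  by apply/funext => n; rewrite /itinerary_code ijE.
have [ij|ij|//] := ltgtP i j.
- by have [] := @ko_lt _ _ _ O i j 0 0 gi gj ij.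
- by have [] := @ko_lt _ _ _ O j i 0 0 gj gi ij; rewrite itE.
Qed.

(** * Recovery of the gluing indices from the kneading set *)

Section KneadingCodes.
Context {t t' : int -> int} {gl gl' : int -> Prop} {sg sg' : int -> sign}.
Hypotheses (D : folding_data t gl sg) (D' : folding_data t' gl' sg').
Hypotheses (O : kneading_order t gl sg) (O' : kneading_order t' gl' sg').
Hypothesis KE : kneading_codes t gl sg = kneading_codes t' gl' sg'.

(* Two basic points correspond when they are the same iterate of gluing      *)
(* points with the same kneading sequence.                                   *)
Let corr i i' := exists m j j', [/\ gl j, gl' j',
  kneading_code t sg j = kneading_code t' sg' j',
  i = iter m t j & i' = iter m t' j'].

(** The correspondence is the graph of an increasing surjection fixing 0, hence the identity, and it
    sends gluing indices to gluing indices. *)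
Lemma kneading_codes_gl i : gl i -> gl' i.
Proof.
have glK j : gl j -> exists2 j', gl' j' &
    kneading_code t sg j = kneading_code t' sg' j'.
  by move=> gj; have [j' ? ?] : kneading_codes t' gl' sg' (kneading_code t sg j);
    [rewrite -KE; exists j|exists j'].
have glK' j' : gl' j' -> exists2 j, gl j &
    kneading_code t sg j = kneading_code t' sg' j'.
  by move=> gj; have [j ? ?] : kneading_codes t gl sg (kneading_code t' sg' j');
    [rewrite KE; exists j'|exists j].
have corr_ex i0 : exists i', corr i0 i'.
  have [m [j [gj ->]]] := gluing_origin D i0; have [j' gj' jE] := glK j gj.
  by exists (iter m t' j'), m, j, j'.
have corr_surj i' : exists i0, corr i0 i'.
  have [m [j' [gj' ->]]] := gluing_origin D' i'; have [j gj jE] := glK' j' gj'.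
  by exists (iter m t j), m, j, j'.
have itE m j j' : kneading_code t sg j = kneading_code t' sg' j' ->
    itinerary_code t sg j m = itinerary_code t' sg' j' m.
  by move=> jE; apply/funext => n; rewrite /itinerary_code jE.
have corr_lt i1 i2 i1' i2' : corr i1 i1' -> corr i2 i2' -> i1 < i2 -> i1' < i2'.
  move=> [m1 [j1 [j1' [g1 g1' E1 -> ->]]]] [m2 [j2 [j2' [g2 g2' E2 -> ->]]]] lt12.
  have [neq12 itlt12] := ko_lt O g1 g2 lt12.
  have [//|lt21|eq12] := ltgtP (iter m1 t' j1') (iter m2 t' j2').
    have [_ itlt21] := ko_lt O' g2' g1' lt21.
    move: itlt21; rewrite -(itE m1 _ _ E1) -(itE m2 _ _ E2) => itlt21.
    by have := itin_lt_asym neq12 itlt12 itlt21.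
  have [mE jE] := gluing_origin_inj D' g1' g2' eq12.
  by case: neq12; rewrite (itE m1 _ _ E1) (itE m2 _ _ E2) mE jE.
have corr_fun i0 i1 i2 : corr i0 i1 -> corr i0 i2 -> i1 = i2.
  move=> [m1 [j1 [j1' [g1 g1' E1 -> ->]]]] [m2 [j2 [j2' [g2 g2' E2 jE ->]]]].
  have [-> jE'] := gluing_origin_inj D g1 g2 jE.
  congr iter; apply: (kneading_code_inj D' O') => //.
  by rewrite -E1 -E2 jE'.
have [phi phiP] := choice corr_ex.
have phi_id : forall i0, phi i0 = i0.
  apply: increasing_bijection_id.
  - by move=> i1 i2; apply: corr_lt.
  - by move=> i'; have [i0 ci] := corr_surj i'; exists i0; apply: corr_fun ci.
  - have [j' gj' jE] := glK 0 (fd_gl0 D).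
    have j'0 : j' = 0.
      by apply: (ko_0 O') => // n n1; rewrite -jE (kneading_code0 D).
    apply: (corr_fun 0) => //; exists 0%N, 0, j'; split=> //.
    exact: fd_gl0 D.
move=> gi; have [m [j [j' [gj gj' _ iE i'E]]]] := phiP i.
have [mE _] := @gluing_origin_inj _ _ _ D 0%N m i j gi gj iE.
by move: i'E; rewrite phi_id -mE /= => ->.
Qed.

End KneadingCodes.

(** * Plane geometry of the Lozi map *)

(* With a = l - m and b = l * m, the eigenvalues of the linear part of the   *)
(* Lozi map at its fixed point X are - l and m.                               *)
Definition eigen_params {R : realType} (l m : R) : Prop :=
  [/\ 0 < m, 1 < l, l < 2 & m * (l + 1) < l - 1].

Section PlanarGeometry.
Context {R : realType} (l m : R).
Hypothesis lm : eigen_params l m.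

Local Notation L := (lozi (l - m) (l * m)).
Local Notation z := (1 - m)^-1.
Local Notation X := (fixpt (l - m) (l * m)).
Implicit Types P Q : R * R.

Lemma m_lt1 : m < 1.
Proof.
have [m_gt0 l_gt1 l_lt2 lm_lt] := lm.
have : m * 1 < m * l by rewrite ltr_pM2l.
lra.
Qed.

Lemma lm_neq0 : l * m != 0.
Proof.
have [m_gt0 l_gt1 l_lt2 lm_lt] := lm.
by rewrite mulf_neq0// gt_eqF//; lra.
Qed.

Lemma zE : z * (1 - m) = 1.
Proof.
have [m_gt0 l_gt1 l_lt2 lm_lt] := lm.
by have m1 := m_lt1; rewrite mulVf// gt_eqF//; lra.
Qed.

Lemma z_gt0 : 0 < z.
Proof.
have [m_gt0 l_gt1 l_lt2 lm_lt] := lm.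
by have := m_lt1; rewrite invr_gt0; lra.
Qed.

Lemma X1E : X.1 * (1 + l) = z.
Proof.
have [m_gt0 l_gt1 l_lt2 lm_lt] := lm.
have ? := m_lt1; rewrite /fixpt /=.
have -> : 1 + (l - m) - l * m = (1 + l) * (1 - m) by ring.
by field; rewrite !gt_eqF//; lra.
Qed.

Lemma X2E : X.2 = l * m * X.1.
Proof. by rewrite /fixpt /= mul1r. Qed.

Lemma X1_gt0 : 0 < X.1.
Proof.
have [m_gt0 l_gt1 l_lt2 lm_lt] := lm.
by have := X1E; have := z_gt0; nra.
Qed.

Lemma X2_gt0 : 0 < X.2.
Proof.
have [m_gt0 l_gt1 l_lt2 lm_lt] := lm; have X1 := X1_gt0.
by rewrite X2E mulr_gt0// mulr_gt0//; lra.
Qed.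

(* Up to an additive constant, the left eigenvectors of the linear part of L *)
(* in the right half-plane: [uline] vanishes on the unstable line of X and    *)
(* [sline] on the stable one.                                                 *)
Definition uline P := P.2 + m * (P.1 - z).
Definition sline P := P.2 - X.2 - l * (P.1 - X.1).

Lemma uline_lozi P : 0 <= P.1 -> uline (L P) = m * uline P.
Proof.
have [m_gt0 l_gt1 l_lt2 lm_lt] := lm.
case: P => x y /= x0; rewrite /uline /lozi /= ger0_norm//.
have zm : m * (z * (1 - m)) = m by rewrite zE mulr1.
lra.
Qed.

Lemma sline_lozi P : 0 <= P.1 -> sline (L P) = - l * sline P.
Proof.
have [m_gt0 l_gt1 l_lt2 lm_lt] := lm.
case: P => x y /= x0; rewrite /sline X2E /lozi /= ger0_norm//.
have Xm : l * (X.1 * (1 + l) * (1 - m)) = l by rewrite X1E zE mulr1.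
move: Xm; rewrite /fixpt /=; set x1 := 1 / _; lra.
Qed.

(* The triangle bounded by the unstable line of X, the image of its left part *)
(* and the stable line of the fixed point in the left half-plane.             *)
Definition trapped P :=
  [/\ uline P <= 0, 0 <= (l - 2 * m) * P.2 - l * m * (P.1 - z)
    & 0 <= (l - 1) * (l * P.1 + P.2) + l].

(** The first two sides of the triangle meet at Z = (z, 0), its rightmost vertex. *)
Lemma trapped_le P : trapped P -> P.1 <= z.
Proof.
have [m_gt0 l_gt1 l_lt2 lm_lt] := lm.
case: P => x y [/= q h w]; rewrite /uline /= in q.
have ml : m < m * l by rewrite -[X in X < _]mulr1 ltr_pM2l.
have lm2 : 0 < l - 2 * m by lra.
have lmq : (l - 2 * m) * (y + m * (x - z)) <= 0 by rewrite pmulr_rle0.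
have coef_gt0 : 0 < 2 * m * (l - m) by rewrite !mulr_gt0//; lra.
by rewrite -subr_le0 -(pmulr_rle0 _ coef_gt0); lra.
Qed.

Lemma trapped_lozi P : trapped P -> trapped (L P).
Proof.
have [m_gt0 l_gt1 l_lt2 lm_lt] := lm.
case: P => x y; move=> /[dup] /trapped_le /= xz.
rewrite /trapped /uline /lozi /= => -[q h w].
have zE := zE; have m_lt1 := m_lt1; have z0 := z_gt0.
have b0 : 0 < l * m by rewrite mulr_gt0//; lra.
have ml : m < m * l by rewrite -[X in X < _]mulr1 ltr_pM2l.
have lm2 : 0 < l - 2 * m by lra.
have bz : l * m * (z * (1 - m)) = l * m by rewrite zE mulr1.
have mz : m * (z * (1 - m)) = m by rewrite zE mulr1.
have mq : m * (y + m * (x - z)) <= 0 by rewrite pmulr_rle0.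
have bq : l * m * (y + m * (x - z)) <= 0 by rewrite pmulr_rle0.
have [x0|x0] := leP 0 x.
  have bx : 0 <= l * m * (l - m) * x by rewrite mulr_ge0// mulr_ge0; lra.
  rewrite ger0_norm//; split; [lra|lra|].
  (* This sign makes [1 + y - (l - 2 * m) * x] decrease to the right along the side through Z
     bounding the triangle from below, so its value at Z, [(1 + m - l) * z], is a lower bound. *)
  have lm4 : 0 <= (l - m) * (l - 4 * m).
    rewrite mulr_ge0//; first by lra.
    have : 0 <= l ^+ 2 - 3 * l + 4 by nra.
    have : (l + 1) * (l - 4 * m) >= l ^+ 2 - 3 * l + 4 by lra.
    by move=> H1 H2; rewrite -(pmulr_rge0 _ (_ : 0 < l + 1)); lra.
  have : (l - 2 * m) * (1 + y - (l - 2 * m) * x) >=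
         (l - 2 * m) * ((1 + m - l) * z).
    have : 0 <= (l - m) * (l - 4 * m) * (z - x) by rewrite mulr_ge0// subr_ge0.
    have : (l - 2 * m) * (z * (1 - m)) = l - 2 * m by rewrite zE mulr1.
    lra.
  rewrite ler_pM2l// => H.
  have : (l - 1) * ((1 + m - l) * z) + 1 >= 0.
    have -> : (l - 1) * ((1 + m - l) * z) + 1 = z * ((2 - l) * (l - m)).
      by rewrite -[X in _ + X]zE; ring.
    by rewrite mulr_ge0 ?mulr_ge0//; lra.
  have H' : (l - 1) * ((1 + m - l) * z) <= (l - 1) * (1 + y - (l - 2 * m) * x).
    by rewrite ler_pM2l//; lra.
  move=> H2; have : 0 <= l * ((l - 1) * (1 + y - (l - 2 * m) * x) + 1).
    by rewrite mulr_ge0//; lra.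
  lra.
have mx : 0 <= m * (l - m) * - x by rewrite mulr_ge0// ?mulr_ge0//; lra.
rewrite ltr0_norm//; split; [lra|lra|].
by have := mulr_ge0 (ltW (lt_trans ltr01 l_gt1)) w; lra.
Qed.

Lemma trapped_bounded : exists B, forall P, trapped P -> `|P.1| <= B.
Proof.
have [m_gt0 l_gt1 l_lt2 lm_lt] := lm.
have l1 : 0 < l - 1 by lra.
have ml : m < m * l by rewrite -[X in X < _]mulr1 ltr_pM2l.
have lm_gt0 : 0 < l - m by lra.
pose d1 := l / (l - 1); have d1E : d1 * (l - 1) = l by rewrite divfK ?gt_eqF.
pose d2 := (d1 + m * z) / (l - m).
have d2E : d2 * (l - m) = d1 + m * z by rewrite divfK ?gt_eqF.
have d1_gt0 : 0 < d1 by rewrite divr_gt0//; lra.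
have mz0 : 0 < m * z by rewrite mulr_gt0// z_gt0.
have d2_gt0 : 0 < d2 by rewrite divr_gt0//; lra.
exists (z + d2) => -[x y] /[dup] /trapped_le /= xz [/= q h w].
rewrite /uline /= in q; have z0 := z_gt0.
have H1 : 0 <= l * x + y + d1 by rewrite -(pmulr_rge0 _ l1); lra.
have H2 : 0 <= x + d2 by rewrite -(pmulr_rge0 _ lm_gt0); lra.
by rewrite ler_norml; lra.
Qed.

Lemma trapped_uline P : uline P = 0 -> 0 <= P.1 <= z -> trapped P.
Proof.
have [m_gt0 l_gt1 l_lt2 lm_lt] := lm.
rewrite /trapped /uline => q /andP[x0 xz]; have ? := m_lt1.
have ml : m < m * l by rewrite -[X in X < _]mulr1 ltr_pM2l.
have y0 : 0 <= P.2 by have := mulr_ge0 (ltW m_gt0) (_ : 0 <= z - P.1); lra.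
split; first by rewrite q.
  have : 0 <= (l - 2 * m) * P.2 by rewrite mulr_ge0//; lra.
  have : 0 <= l * m * (z - P.1) by rewrite !mulr_ge0//; lra.
  lra.
have : 0 <= l * P.1 by rewrite mulr_ge0//; lra.
move=> lx; have : 0 <= (l - 1) * (l * P.1 + P.2) by rewrite mulr_ge0//; lra.
lra.
Qed.

Let slope := (l - m - 1 + l * m) / 2.
Let expansion := (l - m + 1 - l * m) / 2.

(* The constants make the cone |dy| <= slope * |dx| invariant under both     *)
(* linear parts of L, which expand dx at least by the factor [expansion] > 1. *)
Definition left_in_cone P Q :=
  0 < Q.1 - P.1 /\ `|Q.2 - P.2| <= slope * (Q.1 - P.1).

Lemma left_in_cone_lt P Q : left_in_cone P Q -> P.1 < Q.1.
Proof. by case; rewrite subr_gt0. Qed.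

(** With a = l - m and b = l * m, [slope] is the mean of b and a - 1, and [expansion] is a -
    [slope]. As b < a - 1, this gives b < [slope] and [expansion] > 1. *)
Let slope_gt : m < slope /\ l * m <= slope * expansion.
Proof.
have [m_gt0 l_gt1 l_lt2 lm_lt] := lm.
have ml : m < m * l by rewrite -[X in X < _]mulr1 ltr_pM2l.
have b_lt : l * m < slope by rewrite /slope; lra.
split; first by lra.
apply: (le_trans (ltW b_lt)); rewrite ler_peMr//; first by lra.
by rewrite /expansion; lra.
Qed.

Lemma expansion_gt1 : 1 < expansion.
Proof.
have [m_gt0 l_gt1 l_lt2 lm_lt] := lm.
by rewrite /expansion; lra.
Qed.

Let cone_image dx D : 0 < dx -> expansion * dx <= D ->
  0 < D /\ `|l * m * dx| <= slope * D.
Proof.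
have [m_gt0 l_gt1 l_lt2 lm_lt] := lm; have e1 := expansion_gt1.
have [m_s b_s] := slope_gt.
move=> dx0 dxD; split; first by apply: lt_le_trans dxD; rewrite mulr_gt0//; lra.
rewrite ger0_norm; last by rewrite !mulr_ge0//; lra.
apply: (@le_trans _ _ (slope * (expansion * dx))).
  by rewrite mulrA ler_wpM2r// ltW.
by rewrite ler_wpM2l//; lra.
Qed.

Lemma left_in_cone_right P Q : 0 <= P.1 -> 0 <= Q.1 ->
  left_in_cone P Q -> left_in_cone (L Q) (L P) /\
  expansion * (Q.1 - P.1) <= (L P).1 - (L Q).1.
Proof.
move=> P0 Q0 [PQ]; rewrite ler_norml => /andP[H1 H2].
have H : expansion * (Q.1 - P.1) <= (L P).1 - (L Q).1.
  by rewrite /lozi /= !ger0_norm// /expansion; rewrite /slope in H1 H2; lra.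
split=> //; rewrite /left_in_cone.
have -> : (L P).2 - (L Q).2 = - (l * m * (Q.1 - P.1)) by rewrite /=; ring.
by rewrite normrN; exact: cone_image.
Qed.

Lemma left_in_cone_left P Q : P.1 <= 0 -> Q.1 <= 0 ->
  left_in_cone P Q -> left_in_cone (L P) (L Q) /\
  expansion * (Q.1 - P.1) <= (L Q).1 - (L P).1.
Proof.
move=> P0 Q0 [PQ]; rewrite ler_norml => /andP[H1 H2].
have H : expansion * (Q.1 - P.1) <= (L Q).1 - (L P).1.
  by rewrite /lozi /= !ler0_norm// /expansion; rewrite /slope in H1 H2; lra.
split=> //; rewrite /left_in_cone.
have -> : (L Q).2 - (L P).2 = l * m * (Q.1 - P.1) by rewrite /=; ring.
exact: cone_image.
Qed.

Lemma left_in_cone_uline P Q : uline P = 0 -> uline Q = 0 -> P.1 < Q.1 ->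
  left_in_cone P Q.
Proof.
have [m_gt0 l_gt1 l_lt2 lm_lt] := lm; have [m_s _] := slope_gt.
rewrite /uline => P0 Q0 PQ; split; first by rewrite subr_gt0.
have -> : Q.2 - P.2 = - (m * (Q.1 - P.1)) by lra.
rewrite normrN ger0_norm; last by rewrite mulr_ge0//; lra.
by rewrite ler_wpM2r ?subr_ge0// ltW.
Qed.

End PlanarGeometry.

Lemma pow_bounded_le0 (R : realType) (k d B : R) : 1 < k ->
  (forall n, k ^+ n * d <= B) -> d <= 0.
Proof.
move=> k1 H; rewrite leNgt; apply/negP => d0.
have bern n : 1 + n%:R * (k - 1) <= k ^+ n.
  elim: n => [|n IH]; first by rewrite mul0r addr0 expr0.
  have k0 : 0 <= k by lra.
  have n0 : 0 <= n%:R * (k - 1) ^+ 2 by rewrite mulr_ge0// sqr_ge0.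
  by have := ler_wpM2l k0 IH; rewrite exprS -natr1; lra.
have kd : 0 < (k - 1) * d by rewrite mulr_gt0// subr_gt0.
have := archi_boundP (normr_ge0 (B / ((k - 1) * d))).
set n := Num.bound _ => Hn; have := H n; apply/negP; rewrite -ltNge.
have : B < n%:R * ((k - 1) * d).
  by rewrite -ltr_pdivrMr//; apply: le_lt_trans Hn; exact: ler_norm.
by have := ler_wpM2r (ltW d0) (bern n); lra.
Qed.

(** Here [l] and [- m] are the roots of X^2 = a X + b. The condition [m * (l + 1) < l - 1] is b < a
    - 1, and [l < 2] comes from 2a + b < 4. *)
Lemma param_region_eigen (R : realType) (a b : R) : param_region a b ->
  exists l m, [/\ a = l - m, b = l * m, 0 < m, 1 < l
    & [/\ l < 2, m * (l + 1) < l - 1 & ptZ a b = ((1 - m)^-1, 0)]].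
Proof.
move=> [b0 ha hb ab4].
have a0 : 0 < a.
  have s0 : 0 < Num.sqrt 2 :> R by rewrite sqrtr_gt0.
  by rewrite -(pmulr_lgt0 _ s0); lra.
have a_gt1 : 1 < a /\ b < a - 1.
  have D0 : 0 < 2 * a + 1 by lra.
  move: hb; rewrite ltr_pdivlMr// => hb.
  have a1 : 1 < a by nra.
  by split=> //; nra.
have [a1 ba] := a_gt1; pose r := Num.sqrt (a ^+ 2 + 4 * b).
have r0 : 0 <= r by exact: sqrtr_ge0.
have rE : r ^+ 2 = a ^+ 2 + 4 * b by rewrite sqr_sqrtr//; nra.
have ar : a < r by nra.
pose l := (a + r) / 2; have l1 : 1 < l by rewrite /l; lra.
have lE : l ^+ 2 = a * l + b by rewrite /l; lra.
pose m := b / l; have bE : b = l * m by rewrite /m mulrC divfK ?gt_eqF//; lra.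
have aE : a = l - m.
  have l0 : l != 0 by rewrite gt_eqF//; lra.
  by apply: (mulfI l0); rewrite mulrBr -bE; lra.
have m0 : 0 < m by rewrite divr_gt0//; lra.
exists l, m; split=> //; split.
- rewrite ltNge; apply/negP => l2.
  suff : 0 <= (l - 2) * (l + 2 - a) by lra.
  by apply: mulr_ge0; lra.
- by lra.
- rewrite /ptZ -/r; congr pair.
  have m1 : m < 1 by nra.
  have -> : 1 + a - b = (1 + l) * (1 - m) by lra.
  have -> : 2 + a + r = 2 * (1 + l) by rewrite /l; lra.
  by field; rewrite !gt_eqF//; lra.
Qed.

(** The map and its inverse read in the parameter of the unstable manifold, as [f] and [g]. *)
Record unstable_dynamics (R : realType) (l m : R) (gam : R -> R * R)
    (f g : R -> R) : Prop := UnstableDynamics {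
  ud_cont : continuous gam;
  ud_inj : injective gam;
  ud_0 : gam 0 = fixpt (l - m) (l * m);
  ud_right : \forall t \near 0^'+, (fixpt (l - m) (l * m)).1 < (gam t).1;
  ud_f : forall s, gam (f s) = lozi (l - m) (l * m) (gam s);
  ud_fK : cancel f g;
  ud_gK : cancel g f;
  ud_decr : forall s u, s < u -> f u < f s;
  ud_back : forall s,
    (fun n : nat => iter n (lozi_inv (l - m) (l * m)) (gam s)) @ \oo -->
      fixpt (l - m) (l * m)
}.

(** * Dynamics on the unstable manifold *)

Lemma unstable_lozi_inv (R : realType) (a b : R) (P : R * R) :
  unstable a b (lozi_inv a b P) <-> unstable a b P.
Proof.
have shift A n : A (iter n (lozi_inv a b) (lozi_inv a b P)) <->
    A (iter n.+1 (lozi_inv a b) P) by rewrite iterSr.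
split=> H A /H[N _ NA].
- by exists N.+1 => // -[//|n] nN; apply/shift/NA.
- by exists N => // n nN; apply/shift/NA/leqW.
Qed.

Lemma unstable_dynamics_ex (R : realType) (l m : R) (gam : R -> R * R) :
  l * m != 0 -> unstable_param (l - m) (l * m) gam ->
  exists f g, unstable_dynamics l m gam f g.
Proof.
move=> b0 [[gamC gamI] gamR gam0 gamX gamD].
have back s : unstable (l - m) (l * m) (gam s) by rewrite -gamR; exists s.
have ex_f s : exists u, gam u = lozi (l - m) (l * m) (gam s).
  suff : unstable (l - m) (l * m) (lozi (l - m) (l * m) (gam s)).
    by rewrite -gamR => -[u _ uE]; exists u.
  by apply/unstable_lozi_inv; rewrite loziK.
have ex_g s : exists u, gam u = lozi_inv (l - m) (l * m) (gam s).
  suff : unstable (l - m) (l * m) (lozi_inv (l - m) (l * m) (gam s)).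
    by rewrite -gamR => -[u _ uE]; exists u.
  by apply/unstable_lozi_inv.
have [f fE] := choice ex_f; have [g gE] := choice ex_g.
exists f, g; split=> //.
- by move=> s; apply: gamI; rewrite gE fE loziK.
- by move=> s; apply: gamI; rewrite fE gE lozi_invK.
- by move=> s u; apply: gamD.
Qed.

Section Dynamics.
Context {R : realType} {l m : R} {gam : R -> R * R} {f g : R -> R}.
Hypotheses (lm : eigen_params l m) (U : unstable_dynamics l m gam f g).

Local Notation L := (lozi (l - m) (l * m)).
Local Notation Linv := (lozi_inv (l - m) (l * m)).
Local Notation z := (1 - m)^-1.
Local Notation X := (fixpt (l - m) (l * m)).
Local Notation x u := (gam u).1.
Local Notation y u := (gam u).2.
Let fK := ud_fK U.
Let gK := ud_gK U.
Implicit Types s u v e : R.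

Lemma gam_g s : gam (g s) = Linv (gam s).
Proof. by rewrite -{2}(gK s) (ud_f U) loziK// lm_neq0. Qed.

Lemma gam_iter_g n s : gam (iter n g s) = iter n Linv (gam s).
Proof. by elim: n => //= n IH; rewrite gam_g IH. Qed.

Lemma gam_iter_f n s : gam (iter n f s) = iter n L (gam s).
Proof. by elim: n => //= n IH; rewrite (ud_f U) IH. Qed.

Lemma f_le s u : s <= u -> f u <= f s.
Proof. by rewrite le_eqVlt => /predU1P[->//|/(ud_decr U)/ltW]. Qed.

Lemma f_lt s u : (f u < f s) = (s < u).
Proof.
by apply/idP/idP => [|/(ud_decr U)//]; apply: contraTT; rewrite -!leNgt => /f_le.
Qed.

Lemma g_lt s u : (g u < g s) = (s < u).
Proof. by rewrite -f_lt !gK. Qed.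

Lemma g_le s u : (g u <= g s) = (s <= u).
Proof. by rewrite !leNgt g_lt. Qed.

Lemma f_0 : f 0 = 0.
Proof.
have [m_gt0 l_gt1 l_lt2 lm_lt] := lm.
apply: (ud_inj U); rewrite (ud_f U) (ud_0 U) /lozi X2E /fixpt /=.
have X1 := X1_gt0 lm; have Xz := X1E lm; have zm := zE lm.
rewrite /fixpt /= in X1 Xz; rewrite ger0_norm ?ltW//; congr pair; last by ring.
have : (1 / (1 + (l - m) - l * m)) * (1 + l) * (1 - m) = 1 by rewrite Xz.
by rewrite mul1r; lra.
Qed.

Lemma g_0 : g 0 = 0. Proof. by rewrite -{1}f_0 fK. Qed.

Lemma gam_near s e : 0 < e -> exists2 d : R, 0 < d &
  forall u, `|s - u| < d -> `|x s - x u| < e /\ `|y s - y u| < e.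
Proof.
move=> e0; have := @ud_cont _ _ _ _ _ _ U s.
move/cvgrPdist_lt => /(_ _ e0)/nbhs_ballP[d d0 H]; exists d => // u su.
have : `|gam s - gam u| < e by apply: H.
by rewrite prod_normE /= gt_max => /andP[].
Qed.

Lemma gam_back_near s e : 0 < e -> exists N, forall n, (N <= n)%N ->
  `|X.1 - x (iter n g s)| < e /\ `|X.2 - y (iter n g s)| < e.
Proof.
move=> e0; have := @ud_back _ _ _ _ _ _ U s.
move/cvgrPdist_lt => /(_ _ e0)[N _ H]; exists N => n /H.
by rewrite gam_iter_g prod_normE /= gt_max => /andP[].
Qed.

Lemma right_near : exists2 d : R, 0 < d & forall u, 0 < u < d -> X.1 < x u.
Proof.
have /nbhs_ballP[d d0 H] := ud_right U.
exists d => // u /andP[u0 ud]; apply: H => //.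
by rewrite /ball /= sub0r normrN gtr0_norm.
Qed.

(** The backward orbit of [s] returns to [s] at every even time, yet converges to the fixed
    point. *)
Lemma f2_fixed s : f (f s) = s -> s = 0.
Proof.
move=> ffs; have ggs : g (g s) = s by rewrite -{1}ffs !fK.
have iter_s n : iter n.*2 g s = s by elim: n => //= n ->.
apply: (ud_inj U); rewrite (ud_0 U).
have close e : 0 < e -> `|X.1 - x s| <= e /\ `|X.2 - y s| <= e.
  move=> /(gam_back_near s)[N /(_ N.*2)]; rewrite iter_s -addnn leq_addr.
  by move=> [//|A B]; split; apply: ltW.
apply/eqP; rewrite eq_sym -subr_eq0 -normr_le0 prod_normE /= ge_max.
by apply/andP; split; apply/ler_addgt0Pr => e /close[A B]; rewrite add0r.
Qed.

Lemma box_near : exists2 d : R, 0 < d & forall u, `|u| < d ->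
  [/\ 0 < x u, 0 < y u, `|x u - X.1| < X.1 & `|y u - X.2| < X.2].
Proof.
have [m_gt0 l_gt1 l_lt2 lm_lt] := lm.
have X1 := X1_gt0 lm.
have X2 := X2_gt0 lm.
have [d1 d10 H1] := gam_near 0 X1; have [d2 d20 H2] := gam_near 0 X2.
exists (Num.min d1 d2); first by rewrite lt_min d10.
move=> u; rewrite lt_min => /andP[u1 u2].
have /H1[B _] : `|0 - u| < d1 by rewrite sub0r normrN.
have /H2[_ A] : `|0 - u| < d2 by rewrite sub0r normrN.
rewrite (ud_0 U) in A B; split; rewrite 1?distrC//.
- by move: B; rewrite ltr_norml; lra.
- by move: A; rewrite ltr_norml; lra.
Qed.

(* If [f \o f] did not push points of the right half away from X, a small    *)
(* arc to the right of X would be forward invariant, hence contained in the  *)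
(* stable line of X, whose right half escapes under the inverse of L.        *)
Lemma stable_arc_empty d : 0 < d ->
  (forall u, 0 < u <= d -> f (f u) <= u) -> False.
Proof.
have [m_gt0 l_gt1 l_lt2 lm_lt] := lm; have l_gt0 : 0 < l by lra.
move=> d0 ffd; have [d1 d1_gt0 box] := box_near.
have [d2 d2_gt0 right] := right_near.
have gn : 0 < g (- (d1 / 2)) by rewrite -{1}g_0 g_lt oppr_lt0 divr_gt0.
pose u := Num.min d (Num.min (d1 / 2) (Num.min (d2 / 2) (g (- (d1 / 2))))).
have u0 : 0 < u by rewrite !lt_min d0 !divr_gt0.
have [ud ud1 ud2 ug] :
    [/\ u <= d, u <= d1 / 2, u <= d2 / 2 & u <= g (- (d1 / 2))].
  by split; rewrite !ge_min lexx ?orbT.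
have fu : - (d1 / 2) <= f u by rewrite -[X in X <= _]gK f_le.
have ffu : f (f u) <= u by apply: ffd; rewrite u0.
have inv n : f u <= iter n f u <= u.
  elim: n => [|n /andP[A B]] /=.
    by rewrite lexx andbT; apply: ltW; rewrite (lt_trans _ u0)// -f_0 f_lt.
  by rewrite f_le// (le_trans _ ffu)// f_le.
have box_iter n : `|iter n f u| < d1.
  by have := inv n; rewrite ltr_norml; lra.
have sl n : sline l m (gam (iter n f u)) = (- l) ^+ n * sline l m (gam u).
  elim: n => [|n IH]; first by rewrite mul1r.
  rewrite iterS (ud_f U) (sline_lozi lm); first by rewrite IH exprS mulrA.
  by have [/ltW] := box _ (box_iter n).
(* Each step multiplies [sline] by [- l], while the orbit stays in a bounded box. *)
have sl0 : sline l m (gam u) = 0.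
  apply/eqP; rewrite -normr_le0.
  apply: (@pow_bounded_le0 _ l _ (X.2 + l * X.1)) => // n.
  have -> : l ^+ n * `|sline l m (gam u)| = `|sline l m (gam (iter n f u))|.
    by rewrite sl normrM normrX normrN (gtr0_norm l_gt0).
  have [_ _ /ltW A /ltW B] := box _ (box_iter n).
  rewrite /sline (le_trans (ler_normB _ _))// lerD//.
  by rewrite normrM (gtr0_norm l_gt0) ler_pM2l.
have X1u : X.1 < x u by apply: right; rewrite u0; lra.
have X2_gt0 := X2_gt0 lm.
have away n : sline l m (gam (iter n g u)) = 0 /\ x u <= x (iter n g u).
  elim: n => // n [sn xn]; rewrite iterS.
  have yn : y (iter n g u) = X.2 + l * (x (iter n g u) - X.1).
    by move: sn; rewrite /sline; lra.
  have xg : x (g (iter n g u)) = y (iter n g u) / (l * m) by rewrite gam_g.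
  have xgE : l * m * x (g (iter n g u)) = y (iter n g u).
    by rewrite xg mulrC divfK// lm_neq0.
  have lm_gt0 : 0 < l * m by rewrite mulr_gt0//; lra.
  have xlarge : x (iter n g u) <= x (g (iter n g u)).
    rewrite -(ler_pM2l lm_gt0) xgE yn X2E.
    have m1 := m_lt1 lm.
    have : 0 <= l * (1 - m) * (x (iter n g u) - X.1) by rewrite !mulr_ge0//; lra.
    by lra.
  split; last exact: le_trans xlarge.
  have := sline_lozi lm (_ : 0 <= x (g (iter n g u))).
  rewrite -(ud_f U) gK sn => /(_ _)/esym/eqP.
  have X1_gt0 := X1_gt0 lm.
  rewrite mulf_eq0 oppr_eq0 gt_eqF/=; last by lra.
  by move=> H; apply/eqP/H; lra.
have e0 : 0 < x u - X.1 by lra.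
have [N /(_ N (leqnn _))[]] := gam_back_near u e0.
have [_ xN] := away N; rewrite distrC ltr_norml; lra.
Qed.

(** Otherwise, by [stable_arc_empty], some smaller positive [u] is moved up. The supremum of the
    points of [u, s] moved up or fixed is then a positive fixed point of the increasing map
    [f \o f], against [f2_fixed]. *)
Lemma lt_f2 s : 0 < s -> s < f (f s).
Proof.
move=> s0; rewrite ltNge; apply/negP => ffs.
apply: (stable_arc_empty s0) => u /andP[u0 us].
rewrite leNgt; apply/negP => lt_u.
pose A := [set v | u <= v <= s /\ v <= f (f v)].
have Au : A u by split; [rewrite lexx|exact: ltW].
have A_ub : ubound A s by move=> v [/andP[]].
have A_sup : has_sup A by split; [exists u|exists s].
have ur : u <= sup A by apply: ub_le_sup => //; exists s.
have rs : sup A <= s by apply: ge_sup => //; exists u.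
have r_le : sup A <= f (f (sup A)).
  apply: ge_sup; first by exists u.
  move=> v Av; have [_ vf] := Av; apply: (le_trans vf).
  by apply/f_le/f_le/ub_le_sup => //; exists s.
have Ar : A (f (f (sup A))).
  split; first by rewrite (le_trans ur r_le) /= (le_trans _ ffs)//; apply/f_le/f_le.
  exact/f_le/f_le.
have r_ge : f (f (sup A)) <= sup A by apply: ub_le_sup => //; exists s.
have /f2_fixed r0 : f (f (sup A)) = sup A by apply/eqP; rewrite eq_le r_ge.
by move: ur; rewrite r0 leNgt u0.
Qed.

Lemma g2_lt s : 0 < s -> 0 < g (g s) < s.
Proof.
move=> s0; have gg0 : 0 < g (g s) by rewrite -{1}g_0 -{1}g_0 !g_lt.
by rewrite gg0; have := lt_f2 gg0; rewrite !gK.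
Qed.

Lemma iter_g2_gt0 k s : 0 < s -> 0 < iter k (g \o g) s.
Proof. by move=> s0; elim: k => //= k /g2_lt/andP[]. Qed.

Lemma iter_g2_small s e : 0 < s -> 0 < e -> exists k, iter k (g \o g) s < e.
Proof.
move=> s0 e0; apply: contrapT => /forallNP Nk.
pose A := [set iter k (g \o g) s | k in [set: nat]].
have A_lb : lbound A e by move=> _ [k _ <-]; rewrite leNgt; apply/negP/Nk.
have A0 : A !=set0 by exists s, 0%N.
have er : e <= inf A by apply: lb_le_inf.
suff : f (f (inf A)) <= inf A.
  by rewrite leNgt lt_f2// (lt_le_trans e0).
apply: lb_le_inf => // _ [k _ <-].
rewrite -[leRHS]gK -[g _ in leRHS]gK.
apply/f_le/f_le/ge_inf; first by exists e.
by exists k.+1.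
Qed.

Definition straight_arc (lo hi : R) :=
  (forall u, lo <= u <= hi -> uline m (gam u) = 0) /\
  (forall u v, lo <= u -> u < v -> v <= hi -> x u < x v).

Lemma straight_arc_sub lo hi lo' hi' : lo <= lo' -> hi' <= hi ->
  straight_arc lo hi -> straight_arc lo' hi'.
Proof.
move=> lo_le hi_le [q_arc x_arc]; split.
  by move=> u /andP[lu uh]; apply: q_arc; rewrite (le_trans lo_le lu) (le_trans uh).
by move=> u v lu uv vh; apply: x_arc => //;
  [exact: le_trans lu|exact: le_trans hi_le].
Qed.

Lemma straight_arc_f lo hi : straight_arc lo hi -> 0 <= x lo ->
  straight_arc (f hi) (f lo).
Proof.
have [m_gt0 l_gt1 l_lt2 lm_lt] := lm.
move=> [q_arc x_arc] xlo.
have bounds u : f hi <= u <= f lo -> lo <= g u <= hi.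
  by move=> /andP[A B]; rewrite -[lo]fK -[hi]fK !g_le B A.
have xpos u : lo <= u <= hi -> 0 <= x u.
  move=> /andP[]; rewrite le_eqVlt => /predU1P[<-//|lu uh].
  by rewrite (le_trans xlo)// ltW// x_arc.
split.
  move=> u /bounds gu; rewrite -(gK u) (ud_f U) uline_lozi ?xpos//.
  by rewrite q_arc ?mulr0.
move=> u v hu uv vl.
have gu : lo <= g u <= hi by apply: bounds; rewrite hu (le_trans (ltW uv)).
have gv : lo <= g v <= hi by apply: bounds; rewrite vl (le_trans hu)// ltW.
have x_lt : x (g v) < x (g u).
  by apply: x_arc; [case/andP: gv|rewrite g_lt|case/andP: gu].
rewrite -[u]gK -[v]gK !(ud_f U) /lozi /= !ger0_norm ?xpos//.
have := q_arc _ gu; have := q_arc _ gv; rewrite /uline => qv qu.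
have : 0 < l * (x (g u) - x (g v)) by rewrite mulr_gt0//; lra.
by lra.
Qed.

(** Backward steps near X divide [uline] by [m < 1] but keep it bounded, so it vanishes. On that
    line the abscissa is injective and continuous in the parameter, hence monotone; [right_near]
    gives the direction. *)
Lemma straight_arc_0 : exists2 d : R, 0 < d & straight_arc (g d) d.
Proof.
have [m_gt0 l_gt1 l_lt2 lm_lt] := lm; have l_gt0 : 0 < l by lra.
have [d1 d1_gt0 box] := box_near; have [d2 d2_gt0 right] := right_near.
have fn : 0 < f (- (d1 / 2)) by rewrite -{1}f_0 f_lt oppr_lt0 divr_gt0.
pose d := Num.min (d1 / 2) (Num.min (d2 / 2) (f (- (d1 / 2)))).
have d0 : 0 < d by rewrite !lt_min !divr_gt0.
have [dd1 dd2 df] : [/\ d <= d1 / 2, d <= d2 / 2 & d <= f (- (d1 / 2))].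
  by split; rewrite !ge_min lexx ?orbT.
have gd : - (d1 / 2) <= g d by rewrite -[X in X <= _]fK g_le.
have ggd : g (g d) <= d by have /andP[_ /ltW] := g2_lt d0.
have gd0 : g d < 0 by rewrite -g_0 g_lt.
have inv n u : g d <= u <= d -> g d <= iter n g u <= d.
  move=> ud; elim: n => //= n /andP[A B].
  by rewrite g_le B /= (le_trans _ ggd)// g_le.
have box_arc u : g d <= u <= d ->
    [/\ 0 < x u, 0 < y u, `|x u - X.1| < X.1 & `|y u - X.2| < X.2].
  by move=> /andP[A B]; apply: box; rewrite ltr_norml; lra.
have q_arc u : g d <= u <= d -> uline m (gam u) = 0.
  move=> ud.
  have qn n : uline m (gam u) = m ^+ n * uline m (gam (iter n g u)).
    elim: n => [|n ->]; first by rewrite mul1r.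
    rewrite -[X in uline m (gam X)]gK (ud_f U) -iterS uline_lozi//.
      by rewrite mulrA -exprSr.
    by have [/ltW] := box_arc _ (inv n.+1 u ud).
  apply/eqP; rewrite -normr_le0.
  apply: (@pow_bounded_le0 _ m^-1 _ (2 * X.2 + m * (2 * X.1 + z))).
    by rewrite invf_gt1//; exact: m_lt1 lm.
  move=> n; rewrite exprVn -ler_pdivlMl ?invr_gt0 ?exprn_gt0// invrK.
  rewrite (qn n) normrM normrX (gtr0_norm m_gt0) ler_pM2l ?exprn_gt0//.
  have [A B C D] := box_arc _ (inv n u ud).
  move: C D; rewrite /uline !ltr_norml => /andP[? ?] /andP[? ?].
  have z0 := z_gt0 lm; have X1 := X1_gt0 lm.
  have : 0 <= m * x (iter n g u) by rewrite mulr_ge0// ltW.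
  have : 0 <= m * (2 * X.1 - x (iter n g u)) by rewrite mulr_ge0 ?ltW//; lra.
  have : 0 <= m * z by rewrite mulr_ge0// ltW.
  by rewrite ler_norml; lra.
exists d => //; split=> // u v gu uv vd.
have x_inj : {in `[g d, d] &, injective (fun u => x u)}.
  move=> s t; rewrite !in_itv /= => sd td xst; apply: (ud_inj U).
  have := q_arc _ sd; have := q_arc _ td; rewrite /uline xst => qt qs.
  move: qs qt xst; case: (gam s) (gam t) => [? ?] [? ?] /= qs qt ->.
  by congr pair; lra.
have x_cont : {within `[g d, d], continuous (fun u => x u)}.
  apply: continuous_subspaceT => s; apply/cvgrPdist_lt => e /(gam_near s)[c c0 H].
  by apply/nbhs_ballP; exists c => // t /H[].
have X1d : X.1 < x d by apply: right; rewrite d0; lra.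
have [u_in v_in] : u \in `[g d, d] /\ v \in `[g d, d].
  by rewrite !in_itv /= gu vd (le_trans gu (ltW uv)) (le_trans (ltW uv)).
have gdd : x (g d) <= x d.
  rewrite leNgt; apply/negP => /ltW x_ge.
  have := segment_continuous_inj_ge x_ge x_cont x_inj.
  move=> /(_ 0 d); rewrite !in_itv /= (ltW gd0) (ltW d0) lexx.
  rewrite (ltW (lt_trans gd0 d0)) => /(_ isT isT); rewrite (ud_0 U).
  by rewrite (leNgt d) d0 (ltW X1d).
have := segment_continuous_inj_le gdd x_cont x_inj v_in u_in.
by rewrite leNgt [RHS]leNgt uv /= => /negbFE.
Qed.

Lemma uline_back s : uline m (gam s) = 0 -> 0 <= x s <= z ->
  [/\ uline m (gam (g s)) = 0, 0 <= x (g s) <= z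
    & x (g s) - X.1 = - l^-1 * (x s - X.1)].
Proof.
have [m_gt0 l_gt1 l_lt2 lm_lt] := lm; have l_gt0 : 0 < l by lra.
move=> qs /andP[xs0 xsz].
have xg : l * x (g s) = z - x s.
  rewrite gam_g /=; have -> : y s = m * (z - x s) by move: qs; rewrite /uline; lra.
  by rewrite !mulrA [l * m * _]mulrC mulfK// lm_neq0.
have xg0 : 0 <= x (g s) by rewrite -(pmulr_rge0 _ l_gt0) xg subr_ge0.
have xgz : x (g s) <= z.
  rewrite -(ler_pM2l l_gt0) xg.
  have : 0 <= (l - 1) * z by rewrite mulr_ge0 ?(ltW (z_gt0 lm))//; lra.
  by lra.
split; last 2 first.
- by rewrite xg0.
- have l0 : l != 0 by rewrite gt_eqF.
  apply: (mulfI l0); rewrite mulrBr xg mulNr mulrN mulVKf//.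
  by have := X1E lm; lra.
have := uline_lozi lm xg0; rewrite -(ud_f U) gK qs => /esym/eqP.
by rewrite mulf_eq0 gt_eqF//= => /eqP.
Qed.

Lemma uline_back2 k s : uline m (gam s) = 0 -> 0 <= x s <= z ->
  [/\ uline m (gam (iter k (g \o g) s)) = 0,
      0 <= x (iter k (g \o g) s) <= z
    & x (iter k (g \o g) s) - X.1 = l^-1 ^+ 2 ^+ k * (x s - X.1)].
Proof.
move=> qs xs; elim: k => [|k [qk xk ek]]; first by rewrite expr0 mul1r.
have [q1 x1 e1] := uline_back qk xk; have [q2 x2 e2] := uline_back q1 x1.
by split=> //=; rewrite e2 e1 ek (exprS (_ ^+ 2)) expr2 !mulNr mulrN opprK !mulrA.
Qed.

Context {z0 : R}.
Hypothesis gam_z0 : gam z0 = (z, 0).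

Let q_z0 : uline m (gam z0) = 0.
Proof. by rewrite /uline gam_z0 /= subrr mulr0 addr0. Qed.

Let x_z0 : 0 <= x z0 <= z.
Proof. by rewrite gam_z0 /= lexx ltW// (z_gt0 lm). Qed.

Lemma x_e0 : x (g z0) = 0.
Proof. by rewrite gam_g gam_z0 /= mul0r. Qed.

Lemma X1_lt_z : X.1 < z.
Proof.
have [m_gt0 l_gt1 l_lt2 lm_lt] := lm; have X1 := X1_gt0 lm.
rewrite -(X1E lm); have : 0 < l * X.1 by rewrite mulr_gt0//; lra.
by lra.
Qed.

(** If [z0] were negative, even backward iterates of E_0 would have small positive parameters, yet
    they stay to the left of X along the unstable line. *)
Lemma z0_gt0 : 0 < z0.
Proof.
have [m_gt0 l_gt1 l_lt2 lm_lt] := lm; have X1 := X1_gt0 lm.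
rewrite ltNge le_eqVlt; apply/negP => /predU1P[z00|z0n].
  by have := X1_lt_z; rewrite -(ud_0 U) -z00 gam_z0 /= ltxx.
have gz0 : 0 < g z0 by rewrite -{1}g_0 g_lt.
have [d d0 rightd] := right_near; have [k kd] := iter_g2_small gz0 d0.
have [q1 x1 _] := uline_back q_z0 x_z0.
have [_ _] := uline_back2 k q1 x1; rewrite x_e0 sub0r => xk.
have := rightd (iter k (g \o g) (g z0)); rewrite kd iter_g2_gt0// -subr_gt0 xk.
move=> /(_ isT); rewrite mulrN oppr_gt0 pmulr_rlt0; first by lra.
by rewrite !exprn_gt0// invr_gt0; lra.
Qed.

(** Pull the arc back by [g \o g] into the small straight arc, then push it forward; it stays in the
    right half-plane, where L is affine. *)
Lemma straight_arc_z0 : straight_arc (g z0) z0.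
Proof.
have [d d0 arc_d] := straight_arc_0.
have [k kd] := iter_g2_small z0_gt0 d0.
have : straight_arc (g (iter k (g \o g) z0)) (iter k (g \o g) z0).
  by apply: straight_arc_sub arc_d; rewrite ?g_le ltW.
elim: (k) => //= j IH arc_j; apply: IH.
set v := iter j (g \o g) z0 in arc_j *.
have [qj xj _] := uline_back2 j q_z0 x_z0; rewrite -/v in qj xj.
have [q1 x1 _] := uline_back qj xj; have [q2 x2 _] := uline_back q1 x1.
have [q3 /andP[x3 _] _] := uline_back q2 x2; have /andP[{}x1 _] := x1.
have := straight_arc_f arc_j x3; rewrite !gK => /straight_arc_f/(_ x1).
by rewrite !gK.
Qed.

Lemma iter_g_in s : exists N, forall n, (N <= n)%N -> g z0 < iter n g s < z0.
Proof.
have stay v : g z0 < v < z0 -> g z0 < g v < z0.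
  move=> /andP[A B]; rewrite g_lt B /=.
  by rewrite (@lt_trans _ _ (g (g z0))) ?g_lt//; have /andP[] := g2_lt z0_gt0.
have gz0 : g z0 < 0 by rewrite -g_0 g_lt z0_gt0.
have ex v : 0 < v -> exists N, g z0 < iter N g v < z0.
  move=> v0; have [k kz] := iter_g2_small v0 z0_gt0; exists k.*2.
  have -> : iter k.*2 g v = iter k (g \o g) v by elim: (k) => //= j ->.
  by rewrite kz (lt_trans gz0)// iter_g2_gt0.
have [N sN] : exists N, g z0 < iter N g s < z0.
  have [s0|s0|->] := ltgtP s 0; [|exact: ex|by exists 0%N; rewrite /= gz0 z0_gt0].
  have [|N] := ex (g s); first by rewrite -{1}g_0 g_lt.
  by rewrite -iterSr => sN; exists N.+1.
exists N => n /subnK <-; elim: (n - N)%N => [//|j IH].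
by rewrite addSn; apply: stay.
Qed.

End Dynamics.

(** * Itineraries and local structure of the unstable manifold *)

Lemma decreasing_bijection_continuous (R : realType) (h k : R -> R) :
  cancel h k -> cancel k h -> (forall s u, s < u -> h u < h s) -> continuous h.
Proof.
move=> hK kK h_lt s; apply/cvgrPdist_lt => e e0.
have h_le u v : h u < h v -> v < u.
  move=> huv; rewrite ltNge; apply/negP; rewrite le_eqVlt => /predU1P[uv|/h_lt].
    by rewrite uv ltxx in huv.
  by rewrite ltNge (ltW huv).
have s_in : s \in `]k (h s + e), k (h s - e)[.
  by rewrite in_itv /=; apply/andP; split; apply: h_le; rewrite kK; lra.
apply: filterS (near_in_itvoo s_in) => u.
rewrite in_itv /= => /andP[/h_lt + /h_lt]; rewrite !kK => A B.
by rewrite ltr_norml; lra.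
Qed.

Definition param_iter (R : realType) (f g : R -> R) (n : int) (s : R) : R :=
  match n with Posz k => iter k f s | Negz k => iter k.+1 g s end.

Section LocalStructure.
Context {R : realType} {l m : R} {gam : R -> R * R} {f g : R -> R} {z0 : R}.
Hypotheses (lm : eigen_params l m) (U : unstable_dynamics l m gam f g)
  (gam_z0 : gam z0 = ((1 - m)^-1, 0)).

Local Notation L := (lozi (l - m) (l * m)).
Local Notation Linv := (lozi_inv (l - m) (l * m)).
Local Notation z := (1 - m)^-1.
Local Notation x u := (gam u).1.
Local Notation F := (param_iter f g).
Let fK := ud_fK U.
Let gK := ud_gK U.
Implicit Types s u v e : R.

Lemma gam_param_iter n s :
  gam (F n s) = lozi_iter (l - m) (l * m) n (gam s).
Proof. by case: n => n; rewrite /F (gam_iter_f U, gam_iter_g lm U). Qed.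

Lemma iter_f_g n s : iter n f (iter n g s) = s.
Proof. by elim: n => // n IH; rewrite iterSr iterS gK. Qed.

Lemma param_iterS (n : int) s : F (n + 1) s = f (F n s).
Proof.
case: n => [n|[|n]]; first by have -> : Posz n + 1 = Posz n.+1 by lia.
  by rewrite /= gK.
by have -> : Negz n.+1 + 1 = Negz n; [lia|rewrite /= gK].
Qed.

Lemma param_iterP (n : int) s : F (n - 1) s = g (F n s).
Proof. by rewrite -{2}(subrK 1 n) param_iterS fK. Qed.

Lemma param_iterD (i j : int) s : F i (F j s) = F (i + j) s.
Proof.
elim/int_updown_ind: i => [|i IH|i IH]; first by rewrite add0r.
- by rewrite param_iterS IH -param_iterS; congr (F _ s); lia.
- by rewrite param_iterP IH -param_iterP; congr (F _ s); lia.
Qed.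

Lemma param_iter_lt (n : int) s u : s < u ->
  if odd `|n|%N then F n u < F n s else F n s < F n u.
Proof.
move=> su; elim/int_updown_ind: n => //= n IH.
- have -> : odd `|(n + 1)%R|%N = ~~ odd `|n|%N by lia.
  by move: IH; rewrite !param_iterS; case: odd => /= /(ud_decr U).
- have -> : odd `|(n - 1)%R|%N = ~~ odd `|n|%N by lia.
  by move: IH; rewrite !param_iterP; case: odd; rewrite /= (g_lt U).
Qed.

Lemma param_iter_in s : exists M : int, forall n : int, n <= M ->
  g z0 < F n s < z0.
Proof.
have [N sN] := iter_g_in lm U gam_z0 s; exists (- N%:Z - 1) => -[n|n] nM.
  lia.
by apply: sN; lia.
Qed.

Lemma x_gt0 u : g z0 < u <= z0 -> 0 < x u.
Proof.
move=> /andP[zu uz]; have [_ x_lt] := straight_arc_z0 lm U gam_z0.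
by rewrite -(x_e0 lm U gam_z0); apply: x_lt.
Qed.

(** Every point is a forward image of a point of [E_0, Z], which lies in the invariant triangle. *)
Lemma x_bounded : exists B, forall s, `|x s| <= B.
Proof.
have [B BP] := trapped_bounded lm; exists B => s; apply: BP.
have [N /(_ N (leqnn N))/andP[sz0 sz1]] := iter_g_in lm U gam_z0 s.
rewrite -(iter_f_g N s) (gam_iter_f U).
move: (iter N g s) sz0 sz1 => u sz0 sz1.
elim: N => [|n IH]; last by have := trapped_lozi lm IH.
have [q_arc x_lt] := straight_arc_z0 lm U gam_z0.
apply: (trapped_uline lm); first by apply: q_arc; rewrite !ltW.
apply/andP; split; first by apply/ltW/x_gt0; rewrite sz0 ltW.
by have := x_lt _ _ (ltW sz0) sz1 (lexx _); rewrite gam_z0 => /ltW.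
Qed.

(** The flag [o] is the orientation flag of [itin_lt]. *)
Definition in_cone (o : bool) P Q :=
  if o then left_in_cone l m Q P else left_in_cone l m P Q.

Let expansion := (l - m + 1 - l * m) / 2.

Let in_cone_norm P Q : left_in_cone l m P Q -> `|Q.1 - P.1| = Q.1 - P.1.
Proof. by move=> /left_in_cone_lt PQ; rewrite gtr0_norm// subr_gt0. Qed.

Lemma in_cone_right o P Q : 0 <= P.1 -> 0 <= Q.1 -> in_cone o P Q ->
  in_cone (~~ o) (L P) (L Q) /\
  expansion * `|Q.1 - P.1| <= `|(L Q).1 - (L P).1|.
Proof.
move=> P0 Q0; case: o => PQ.
  have [PQ' exp] := left_in_cone_right lm Q0 P0 PQ; split=> //.
  by rewrite distrC (in_cone_norm PQ) (in_cone_norm PQ').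
have [PQ' exp] := left_in_cone_right lm P0 Q0 PQ; split=> //.
by rewrite [leRHS]distrC (in_cone_norm PQ) (in_cone_norm PQ').
Qed.

Lemma in_cone_left o P Q : P.1 <= 0 -> Q.1 <= 0 -> in_cone o P Q ->
  in_cone o (L P) (L Q) /\
  expansion * `|Q.1 - P.1| <= `|(L Q).1 - (L P).1|.
Proof.
move=> P0 Q0; case: o => PQ.
  have [PQ' exp] := left_in_cone_left lm Q0 P0 PQ; split=> //.
  by rewrite distrC [leRHS]distrC (in_cone_norm PQ) (in_cone_norm PQ').
have [PQ' exp] := left_in_cone_left lm P0 Q0 PQ; split=> //.
by rewrite (in_cone_norm PQ) (in_cone_norm PQ').
Qed.

Lemma in_cone_neq o P Q : in_cone o P Q -> P.1 <> Q.1.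
Proof. by case: o => /left_in_cone_lt + PQ; rewrite PQ ltxx. Qed.

Section Itineraries.
Context {s u : R} {p q : int -> sign}.
Hypotheses (su : s < u) (pP : itinerary (l - m) (l * m) (gam s) p)
  (qP : itinerary (l - m) (l * m) (gam u) q).

(** Far in the past both points lie on the straight arc, where the left-right order is the parameter
    order, and each step reverses the latter; hence the parity. *)
Lemma in_cone_past : exists M : int, forall n : int, n <= M ->
  [/\ p n = Plus, q n = Plus & in_cone (odd `|n|%N) (gam (F n s)) (gam (F n u))].
Proof.
have [M MP] := param_iter_in s; have [N NP] := param_iter_in u.
have [q_arc x_lt] := straight_arc_z0 lm U gam_z0.
exists (Num.min M N) => n; rewrite le_min => /andP[/MP/andP[s1 s2] /NP/andP[u1 u2]].
split.
- have [_] := pP n; rewrite -gam_param_iter; case: (p n) => // /(_ erefl).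
  by rewrite leNgt x_gt0// s1 ltW.
- have [_] := qP n; rewrite -gam_param_iter; case: (q n) => // /(_ erefl).
  by rewrite leNgt x_gt0// u1 ltW.
- have qs : uline m (gam (F n s)) = 0 by apply: q_arc; rewrite !ltW.
  have qu : uline m (gam (F n u)) = 0 by apply: q_arc; rewrite !ltW.
  have := param_iter_lt n su; rewrite /in_cone.
  case: odd => lt_n; apply: (left_in_cone_uline lm) => //.
    by apply: x_lt => //; rewrite ltW.
  by apply: x_lt => //; rewrite ltW.
Qed.

Lemma in_cone_step n o : in_cone o (gam (F n s)) (gam (F n u)) -> p n = q n ->
  in_cone (if p n is Plus then ~~ o else o)
    (gam (F (n + 1) s)) (gam (F (n + 1) u)) /\
  expansion * `|x (F n u) - x (F n s)| <= `|x (F (n + 1) u) - x (F (n + 1) s)|.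
Proof.
rewrite !param_iterS !(ud_f U) => su_cone pq.
have [+ +] := pP n; have [+ +] := qP n; rewrite -pq -!gam_param_iter.
case: (p n) => H1 H2 H3 H4; first exact: in_cone_right (H3 _) (H1 _) su_cone.
exact: in_cone_left (H4 _) (H2 _) su_cone.
Qed.

Lemma itin_lt_param : itin_lt p q.
Proof.
exists (fun n o => in_cone o (gam (F n s)) (gam (F n u))); split.
- exact: in_cone_past.
- by move=> n o su_cone pq; have [] := in_cone_step su_cone pq.
- move=> n; have [+ +] := pP n; have [+ +] := qP n; rewrite -!gam_param_iter.
  move=> H1 H2 H3 H4; split=> pn qn /left_in_cone_lt; apply/negP; rewrite -leNgt.
    exact: le_trans (H2 _) (H3 _).
  exact: le_trans (H4 _) (H1 _).
Qed.

Lemma shared_past (N : int) : (forall n : int, n < N -> p n = q n) ->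
  exists o, in_cone o (gam (F N s)) (gam (F N u)).
Proof.
move=> pq; have [M MP] := in_cone_past.
have [NM|MN] := leP N M; first by have [_ _ ?] := MP N NM; exists (odd `|N|%N).
have past (k : nat) : M + k%:Z <= N -> exists o,
    in_cone o (gam (F (M + k%:Z) s)) (gam (F (M + k%:Z) u)).
  elim: k => [_|k IH kN].
    by rewrite addr0; have [_ _ ?] := MP M (lexx M); exists (odd `|M|%N).
  have [|c ck] := IH; first by lia.
  have [|ck' _] := in_cone_step ck; first by apply: pq; lia.
  have -> : M + k.+1%:Z = M + k%:Z + 1 by lia.
  by eexists; exact: ck'.
have := past `|(N - M)%R|%N; have -> : M + `|(N - M)%R|%N%:Z = N by lia.
exact.
Qed.

(* As long as two points share their itineraries, the arc joining them is    *)
(* stretched, and the unstable manifold is bounded.                           *)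
Lemma itinerary_inj : p <> q.
Proof.
move=> pq; have [B BP] := x_bounded; have [M MP] := in_cone_past.
have [_ _ cM] := MP M (lexx M); have e1 := expansion_gt1 lm.
have grow (k : nat) : exists2 c,
    in_cone c (gam (F (M + k%:Z) s)) (gam (F (M + k%:Z) u))
    & expansion ^+ k * `|x (F M u) - x (F M s)|
      <= `|x (F (M + k%:Z) u) - x (F (M + k%:Z) s)|.
  elim: k => [|k [c ck grow_k]].
    by rewrite addr0; exists (odd `|M|%N) => //; rewrite expr0 mul1r.
  have [|ck' grow_k'] := in_cone_step ck; first by rewrite pq.
  have -> : M + k.+1%:Z = M + k%:Z + 1 by lia.
  eexists; first exact: ck'.
  apply: le_trans grow_k'; rewrite exprS -mulrA ler_wpM2l//.
  by apply: ltW; apply: lt_trans e1.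
have : `|x (F M u) - x (F M s)| <= 0.
  apply: (@pow_bounded_le0 _ expansion _ (B + B)) => // n.
  have [c _ /le_trans] := grow n; apply.
  by rewrite (le_trans (ler_normB _ _))// lerD.
by rewrite normr_le0 subr_eq0 => /eqP/esym; exact: in_cone_neq cM.
Qed.

End Itineraries.

(** * Crossings and folds of the unstable manifold *)

Lemma g_continuous : continuous g.
Proof.
apply: (decreasing_bijection_continuous gK fK) => s u su.
by rewrite (g_lt U).
Qed.

Lemma f_continuous : continuous f.
Proof. exact: decreasing_bijection_continuous fK gK (ud_decr U). Qed.

Lemma x_near_gt0 s : 0 < x s -> \forall u \near s, 0 < x u.
Proof.
move=> xs; have [d d0 H] := gam_near U s xs.
by apply/nbhs_ballP; exists d => // u /H[+ _]; rewrite ltr_norml; lra.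
Qed.

Lemma x_near_lt0 s : x s < 0 -> \forall u \near s, x u < 0.
Proof.
rewrite -oppr_gt0 => xs; have [d d0 H] := gam_near U s xs.
by apply/nbhs_ballP; exists d => // u /H[+ _]; rewrite ltr_norml; lra.
Qed.

(** Local shapes of the manifold, phrased by cones so that they propagate under [f]: a crossing
    passes through monotonically in the abscissa, a fold has both branches on one side. *)
Definition crossing s := exists o, \forall u \near s,
  (u < s -> in_cone o (gam u) (gam s)) /\
  (s < u -> in_cone (~~ o) (gam u) (gam s)).

Definition folding s := exists o, \forall u \near s,
  u != s -> in_cone o (gam u) (gam s).

Lemma near_g s (P : R -> Prop) : (\forall u \near s, P u) ->
  \forall v \near f s, P (g v).
Proof.
by move=> sP; have := @g_continuous (f s); rewrite /continuous_at fK; apply.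
Qed.

Lemma crossing_f s : crossing s -> x s <> 0 -> crossing (f s).
Proof.
move=> [c /near_g cs] /eqP; rewrite neq_lt => /orP[xs|xs].
  exists (~~ c); have xn := near_g (x_near_lt0 xs).
  move: cs xn; apply: filterS2 => v [A B] xv.
  rewrite -{2 4}[v]gK !(ud_f U); split=> fv.
    by apply: (in_cone_left (ltW xv) (ltW xs) (B _)).1; rewrite -(f_lt U) gK.
  apply: (in_cone_left (ltW xv) (ltW xs) _).1.
  by rewrite negbK; apply: A; rewrite -(f_lt U) gK.
exists c; have xn := near_g (x_near_gt0 xs).
move: cs xn; apply: filterS2 => v [A B] xv.
rewrite -{2 4}[v]gK !(ud_f U); split=> fv.
  rewrite -[c]negbK; apply: (in_cone_right (ltW xv) (ltW xs) (B _)).1.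
  by rewrite -(f_lt U) gK.
by apply: (in_cone_right (ltW xv) (ltW xs) (A _)).1; rewrite -(f_lt U) gK.
Qed.

(** L folds the plane along the vertical axis: points on either side land to the left of the image
    of the crease. *)
Lemma in_cone_axis o P Q : Q.1 = 0 -> in_cone o P Q ->
  in_cone false (L P) (L Q).
Proof.
move=> Q0 /[dup]; case: o => /left_in_cone_lt; rewrite Q0 => P0 PQ.
  by have [] := in_cone_right (ltW P0) (_ : 0 <= Q.1) PQ; rewrite ?Q0.
by have [] := in_cone_left (ltW P0) (_ : Q.1 <= 0) PQ; rewrite ?Q0.
Qed.

Let g_neq v s : v != f s -> g v != s.
Proof. by apply: contraNneq => <-; rewrite gK. Qed.

Lemma folding_of_crossing s : crossing s -> x s = 0 -> folding (f s).
Proof.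
move=> [c /near_g cs] xs; exists false; move: cs; apply: filterS => v [A B] vs.
have := g_neq vs; rewrite -{2}[v]gK !(ud_f U) neq_lt.
by move=> /orP[/A|/B]; exact: in_cone_axis.
Qed.

Lemma folding_f s : folding s -> folding (f s).
Proof.
move=> [c /near_g cs]; have [xs|xs|xs] := ltgtP (x s) 0.
- exists c; move: cs (near_g (x_near_lt0 xs)); apply: filterS2 => v H xv vs.
  rewrite -{1}[v]gK !(ud_f U).
  exact: (in_cone_left (ltW xv) (ltW xs) (H (g_neq vs))).1.
- exists (~~ c); move: cs (near_g (x_near_gt0 xs)); apply: filterS2 => v H xv vs.
  rewrite -{1}[v]gK !(ud_f U).
  exact: (in_cone_right (ltW xv) (ltW xs) (H (g_neq vs))).1.
- exists false; move: cs; apply: filterS => v H vs.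
  by rewrite -{1}[v]gK !(ud_f U); exact: in_cone_axis (H (g_neq vs)).
Qed.

Lemma crossing_sign s : crossing s -> x s = 0 -> exists2 r : sign,
  \forall u \near s, u < s -> has_sign r (x u)
  & \forall u \near s, s < u -> has_sign (if r is Plus then Minus else Plus) (x u).
Proof.
move=> [c cs] xs; exists (if c then Plus else Minus).
  apply: filterS cs => u [+ _] us => /(_ us).
  by case: (c) => /left_in_cone_lt; rewrite xs.
apply: filterS cs => u [_ +] us => /(_ us).
by case: (c) => /left_in_cone_lt; rewrite xs.
Qed.

Lemma folding_sign s : folding s -> exists r : sign,
  \forall u \near s, u != s -> has_sign r (x u).
Proof.
move=> [c cs]; have [xs|xs|xs] := ltgtP (x s) 0.
- by exists Minus; apply: filterS (x_near_lt0 xs).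
- by exists Plus; apply: filterS (x_near_gt0 xs).
- exists (if c then Plus else Minus); apply: filterS cs => u H /H.
  by case: (c) => /left_in_cone_lt; rewrite xs.
Qed.

Lemma gluing_param s : gluing (l - m) (l * m) (gam s) <->
  x s = 0 /\ forall k, (0 < k)%N -> x (iter k g s) <> 0.
Proof.
have E k : (0 < k)%N ->
    lozi_iter (l - m) (l * m) (- k%:Z) (gam s) = gam (iter k g s).
  case: k => // k _; rewrite (_ : - k.+1%:Z = Negz k); last by lia.
  by rewrite -gam_param_iter.
split=> [[_ xs H]|[xs H]]; first by split=> // k k0; rewrite -E//; exact: H.
split=> //; first exact: (@ud_back _ _ _ _ _ _ U s).
by move=> k k0; rewrite E//; exact: H.
Qed.

(** The point comes from the straight arc, where crossing is evident, and its orbit meets no crease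
    before the present. *)
Lemma gluing_crossing s : gluing (l - m) (l * m) (gam s) -> crossing s.
Proof.
move=> /gluing_param[xs xk].
have [N /(_ N (leqnn N))/andP[s0 s1]] := iter_g_in lm U gam_z0 s.
have : crossing (iter N g s).
  have [q_arc x_lt] := straight_arc_z0 lm U gam_z0.
  have s_in : iter N g s \in `]g z0, z0[ by rewrite in_itv /= s0.
  exists false; apply: filterS (near_in_itvoo s_in) => u.
  rewrite in_itv /= => /andP[u0 u1].
  have qu : uline m (gam u) = 0 by apply: q_arc; rewrite !ltW.
  have qs : uline m (gam (iter N g s)) = 0 by apply: q_arc; rewrite !ltW.
  by split=> us; apply: (left_in_cone_uline lm) => //; apply: x_lt => //; rewrite ltW.
elim: (N) => // k IH ck; apply: IH; rewrite -[iter k g s]gK.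
by apply: crossing_f => //; exact: (xk k.+1).
Qed.

Lemma gluing_folding s n : gluing (l - m) (l * m) (gam s) ->
  folding (iter n.+1 f s).
Proof.
move=> gs; elim: n => [|n]; last exact: folding_f.
apply: folding_of_crossing; first exact: gluing_crossing.
by have /gluing_param[] := gs.
Qed.

Lemma basicP P : basic (l - m) (l * m) P <->
  exists2 G, gluing (l - m) (l * m) G & exists n, P = iter n L G.
Proof.
split=> [[gP|[G gG ->]|[_ [G gG ->] [n _ ->]]]|[G gG [[|[|n]] ->]]].
- by exists P => //; exists 0%N.
- by exists G => //; exists 1%N.
- by exists G => //; exists n.+1; rewrite iterSr.
- exact: Or31.
- by apply: Or32; exists G.
- by apply: Or33; exists (L G); [exists G|exists n.+1; rewrite // -iterSr].
Qed.

(** The remote past has positive abscissa, so there is an earliest visit to the axis, and it is a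
    gluing point. *)
Lemma zero_basic s : x s = 0 -> basic (l - m) (l * m) (gam s).
Proof.
move=> xs; have [N sN] := iter_g_in lm U gam_z0 s.
pose P k := x (iter k g s) == 0.
have exP : exists k, P k by exists 0%N; apply/eqP.
have ubP k : P k -> (k <= N)%N.
  move=> /eqP xk; rewrite leqNgt; apply/negP => /ltnW/sN/andP[k0 k1].
  by have := @x_gt0 (iter k g s); rewrite k0 (ltW k1) xk ltxx => /(_ isT).
case: (ex_maxnP exP ubP) => k /eqP xk kmax; apply/basicP.
exists (gam (iter k g s)); last first.
  exists k; rewrite -(gam_iter_f U); congr gam.
  by rewrite iter_f_g.
apply/gluing_param; split=> // j j0; rewrite -iterD => /eqP/kmax.
by rewrite -[X in (_ <= X)%N]add0n leq_add2r leqNgt j0.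
Qed.

End LocalStructure.

(** * Basic points *)

Section Numbering.
Context {R : realType} {l m : R} {gam : R -> R * R} {f g : R -> R}
  {E : int -> R * R} {e : int -> R} {t : int -> int}.
Local Notation a := (l - m).
Local Notation b := (l * m).
Local Notation L := (lozi a b).
Local Notation Linv := (lozi_inv a b).
Local Notation x u := (gam u).1.
Local Notation F := (param_iter f g).
Hypotheses (lm : eigen_params l m) (U : unstable_dynamics l m gam f g)
  (EN : basic_numbering a b gam E) (ZE : ptZ a b = ((1 - m)^-1, 0))
  (eE : forall i, gam (e i) = E i) (tE : forall i, f (e i) = e (t i)).
Let fK := ud_fK U.
Let gK := ud_gK U.
Let gam_inj := ud_inj U.
Implicit Types s u : R.

Let z0 := f (e 0).

Lemma gam_z0 : gam z0 = ((1 - m)^-1, 0).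
Proof.
by rewrite (ud_f U) eE; have [_ -> _] := EN; rewrite lozi_invK ?ZE// lm_neq0.
Qed.

Let e0E : e 0 = g z0. Proof. by rewrite /z0 fK. Qed.

Lemma e_basic s : basic a b (gam s) -> exists i, s = e i.
Proof.
have [<- _ _] := EN; move=> [i _ Ei]; exists i.
by apply: gam_inj; rewrite eE.
Qed.

Lemma basic_E i : basic a b (gam (e i)).
Proof. by rewrite eE; have [<- _ _] := EN; exists i. Qed.

Lemma e_ltS (i : int) : e i < e (i + 1).
Proof.
have [_ _ /(_ i)[s [u [sE uE su]]]] := EN.
have -> : e i = s by apply: gam_inj; rewrite eE sE.
by have -> : e (i + 1) = u by apply: gam_inj; rewrite eE uE.
Qed.

Lemma e_lt (i j : int) : (e i < e j) = (i < j).
Proof.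
have homo i' (k : nat) : e i' < e (i' + k.+1%:Z).
  elim: k => [|k IH]; first exact: e_ltS.
  apply: (lt_trans IH); have -> : i' + k.+2%:Z = i' + k.+1%:Z + 1 by lia.
  exact: e_ltS.
have lt_e i' j' : i' < j' -> e i' < e j'.
  move=> ij; have := homo i' `|(j' - i' - 1)%R|%N.
  by have -> : i' + `|(j' - i' - 1)%R|%N.+1%:Z = j' by lia.
have [/lt_e//|/lt_e ji|->] := ltgtP i j; last by rewrite ltxx.
by rewrite ltNge (ltW ji).
Qed.

Lemma e_le (i j : int) : (e i <= e j) = (i <= j).
Proof. by rewrite !leNgt e_lt. Qed.

Lemma e_inj : injective e.
Proof.
by move=> i j ij; apply/eqP; rewrite eq_le -!e_le ij lexx.
Qed.

Definition is_gluing i := gluing a b (E i).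

Lemma is_gluingE i : is_gluing i <->
  x (e i) = 0 /\ forall k, (0 < k)%N -> x (iter k g (e i)) <> 0.
Proof. by rewrite /is_gluing -eE; exact: gluing_param U _. Qed.

Lemma t_lt (i j : int) : i < j -> t j < t i.
Proof. by rewrite -e_lt => /(ud_decr U); rewrite !tE e_lt. Qed.

Let iter_g_f n : cancel (iter n f) (iter n g).
Proof. by elim: n => // n IH s; rewrite iterSr iterS fK. Qed.

Lemma iter_te n i : iter n f (e i) = e (iter n t i).
Proof. by elim: n => //= n ->. Qed.

Lemma basic_e_origin i : exists n j, is_gluing j /\ i = iter n t j.
Proof.
have /basicP[G gG [n iE]] := basic_E i.
have /e_basic[j jE] : basic a b (gam (iter n g (e i))).
  by apply/basicP; exists G => //; exists 0%N; rewrite /= (gam_iter_g lm U) iE;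
     elim: (n) => // k IH; rewrite iterSr iterS loziK ?lm_neq0.
have GE : G = E j.
  rewrite -eE -jE (gam_iter_g lm U) iE.
  by elim: (n) => // k IH; rewrite iterSr iterS loziK ?lm_neq0.
exists n, j; split; first by rewrite /is_gluing -GE.
by apply: e_inj; rewrite -iter_te -jE (iter_f_g U).
Qed.

Lemma is_gluingP i : is_gluing i <-> forall j, t j <> i.
Proof.
split=> [/is_gluingE[_ xi] j tj|it].
  have [n [j' [/is_gluingE[xj' _] jE]]] := basic_e_origin j.
  apply: (xi n.+1) => //; rewrite -tj -tE jE -iter_te -iterS.
  by rewrite iter_g_f.
have [[|n] [j [gj iE]]] := basic_e_origin i; first by rewrite iE.
by case: (it (iter n t j)).
Qed.

Let z0_gt0 := z0_gt0 lm U gam_z0.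

Let g_stay s : g z0 < s < z0 -> g z0 < g s < z0.
Proof.
move=> /andP[A B]; rewrite (g_lt U) B /=.
rewrite (@lt_trans _ _ (g (g z0))) ?(g_lt U)//.
by have /andP[] := g2_lt lm U z0_gt0.
Qed.

(** Its gluing origin would lie in the same arc, which is stable under [g] and has positive
    abscissa. *)
Lemma no_basic_near_X i : ~ (g z0 < e i < z0).
Proof.
move=> ei; have [n [j [/is_gluingE[xj _] iE]]] := basic_e_origin i.
have ej : g z0 < e j < z0.
  have -> : e j = iter n g (e i).
    by rewrite iE -iter_te iter_g_f.
  by elim: (n) => //= k; exact: g_stay.
have : 0 < x (e j).
  by apply: (x_gt0 lm U gam_z0); case/andP: ej => -> /ltW.
by rewrite xj ltxx.
Qed.

Lemma t_0 : t 0 = 1.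
Proof.
have z0E : z0 = e (t 0) by rewrite -tE.
have t0_gt0 : 0 < t 0.
  by rewrite -e_lt -z0E e0E (lt_trans _ z0_gt0)// -(g_0 lm U) (g_lt U).
have : e 1 <= z0 by rewrite z0E e_le; lia.
rewrite le_eqVlt z0E => /predU1P[/e_inj//|lt_1].
by have := @no_basic_near_X 1; rewrite -e0E e_lt z0E lt_1.
Qed.

Let z0E : z0 = e 1. Proof. by rewrite -t_0 -tE. Qed.

(** If [t 1 < -1], then E_{-1} has no basic preimage, so it is a gluing point. But it lies on the
    straight image of [E_0, Z], strictly to the left of E_0, which is already on the axis. *)
Lemma t_1 : t 1 = -1.
Proof.
have gg : g (g z0) < z0 by have /andP[] := g2_lt lm U z0_gt0.
have t1_lt0 : t 1 < 0.
  by rewrite -e_lt -tE -z0E e0E -[g z0]gK (f_lt U).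
have [lt_t1|] := ltP (t 1) (-1); last by lia.
have e_in : g z0 < g (e (-1)) < z0.
  by rewrite (g_lt U) z0E e_lt /= -[e 1]fK (g_lt U) tE e_lt.
have : is_gluing (-1).
  apply/is_gluingP => j tj; apply: (@no_basic_near_X j).
  by rewrite -(fK (e j)) tE tj.
move=> /is_gluingE[x_0 _].
have [_ x_lt] : @straight_arc R m gam (f z0) (f (g z0)).
  apply: (straight_arc_f lm U (straight_arc_z0 lm U gam_z0)).
  by rewrite (x_e0 lm U gam_z0).
have : x (e (-1)) < x (e 0).
  by apply: x_lt; [rewrite z0E tE e_le; lia|rewrite e_lt|rewrite gK z0E e_le].
by rewrite x_0 e0E (x_e0 lm U gam_z0) ltxx.
Qed.

Definition arc_sign (i : int) : sign :=
  if 0 < x ((e i + e (i + 1)) / 2) then Plus else Minus.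

Lemma x_neq0_arc (i : int) s : e i < s < e (i + 1) -> x s <> 0.
Proof.
move=> + /(zero_basic lm U gam_z0)/e_basic[j sj].
by rewrite sj !e_lt; lia.
Qed.

Lemma arc_signP (i : int) s : e i < s < e (i + 1) -> has_sign (arc_sign i) (x s).
Proof.
have x_cont (v w : R) : {within `[v, w], continuous (fun u => x u)}.
  apply: continuous_subspaceT => v'; apply/cvgrPdist_lt => d /(gam_near U v')[c c0 H].
  by apply/nbhs_ballP; exists c => // u /H[].
have same u v : e i < u -> u <= v -> v < e (i + 1) -> (0 < x u) = (0 < x v).
  move=> iu uv vi.
  have nz w : u <= w <= v -> x w <> 0.
    move=> /andP[uw wv]; apply: (@x_neq0_arc i).
    by rewrite (lt_le_trans iu uw) (le_lt_trans wv vi).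
  apply/idP/idP => [xu0|xv0]; rewrite ltNge; apply/negP => x0.
    have minmax : Num.min (x u) (x v) <= 0 <= Num.max (x u) (x v).
      by rewrite ge_min le_max x0 (ltW xu0) orbT.
    by have [c] := IVT uv (@x_cont u v) minmax; rewrite in_itv /= => /nz.
  have minmax : Num.min (x u) (x v) <= 0 <= Num.max (x u) (x v).
    by rewrite ge_min le_max x0 (ltW xv0) orbT.
  by have [c] := IVT uv (@x_cont u v) minmax; rewrite in_itv /= => /nz.
move=> /[dup] /x_neq0_arc xs /andP[is1 si]; have ei := e_ltS i.
have sE : (0 < x s) = (0 < x ((e i + e (i + 1)) / 2)).
  by have [sm|/ltW ms] := leP s ((e i + e (i + 1)) / 2);
    [apply: same|apply/esym/same] => //; lra.
rewrite /arc_sign -sE; case: ltP => //= x_le0.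
by rewrite lt_neqAle x_le0 andbT; apply/eqP.
Qed.

Let near_right s u (P : R -> Prop) : s < u -> (\forall v \near s, P v) ->
  exists2 v, s < v < u & P v.
Proof.
move=> su /nbhs_ballP[d /= d0 H]; exists (s + Num.min (d / 2) ((u - s) / 2)).
  have : Num.min (d / 2) ((u - s) / 2) <= (u - s) / 2 by rewrite ge_min lexx orbT.
  have : 0 < Num.min (d / 2) ((u - s) / 2).
    by rewrite lt_min !divr_gt0// subr_gt0.
  lra.
apply: H; rewrite /ball /= opprD addrA subrr sub0r normrN gtr0_norm.
  by rewrite gt_min; apply/orP; left; lra.
by rewrite lt_min !divr_gt0// subr_gt0.
Qed.

Let near_left u s (P : R -> Prop) : u < s -> (\forall v \near s, P v) ->
  exists2 v, u < v < s & P v.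
Proof.
move=> su /nbhs_ballP[d /= d0 H]; exists (s - Num.min (d / 2) ((s - u) / 2)).
  have : Num.min (d / 2) ((s - u) / 2) <= (s - u) / 2 by rewrite ge_min lexx orbT.
  have : 0 < Num.min (d / 2) ((s - u) / 2).
    by rewrite lt_min !divr_gt0// subr_gt0.
  lra.
apply: H; rewrite /ball /= opprB addrC subrK gtr0_norm.
  by rewrite gt_min; apply/orP; left; lra.
by rewrite lt_min !divr_gt0// subr_gt0.
Qed.

Let has_sign_inj (r r' : sign) (v : R) : has_sign r v -> has_sign r' v -> r = r'.
Proof. by case: r; case: r' => //= H /(lt_trans H); rewrite ltxx. Qed.

Lemma arc_sign_gl (i : int) : is_gluing i -> arc_sign i <> arc_sign (i - 1).
Proof.
move=> gi; have [xi _] := (is_gluingE i).1 gi.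
have ci : @crossing R l m gam (e i).
  by apply: (gluing_crossing lm U gam_z0); rewrite eE.
have [r left_r right_r] := crossing_sign ci xi.
have [v vi rv] := near_right (e_ltS i) right_r.
have i1 : e (i - 1) < e i by rewrite e_lt; lia.
have [w wi rw] := near_left i1 left_r.
have /andP[v1 _] := vi; have /andP[_ w1] := wi.
rewrite (has_sign_inj (arc_signP vi) (rv v1)).
rewrite -(has_sign_inj (rw w1) (@arc_signP (i - 1) w _)) ?subrK//.
by case: (r).
Qed.

Lemma arc_sign_ngl (i : int) : ~ is_gluing i ->
  arc_sign i = arc_sign (i - 1) /\
  \forall u \near e i, u != e i -> has_sign (arc_sign i) (x u).
Proof.
move=> ngi; have [[|n] [j [gj iE]]] := basic_e_origin i; first by rewrite iE in ngi.
have fi : @folding R l m gam (e i).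
  by rewrite iE -iter_te; apply: (gluing_folding lm U gam_z0); rewrite eE.
have [r rP] := folding_sign U fi.
have [v vi rv] := near_right (e_ltS i) rP.
have i1 : e (i - 1) < e i by rewrite e_lt; lia.
have [w wi rw] := near_left i1 rP.
have /andP[v1 _] := vi; have /andP[_ w1] := wi.
have riE : arc_sign i = r.
  by apply: has_sign_inj (arc_signP vi) (rv _); rewrite gt_eqF.
split; last by rewrite riE.
rewrite riE; apply: has_sign_inj (rw _) (@arc_signP (i - 1) w _); rewrite ?subrK//.
by rewrite lt_eqF.
Qed.

Lemma numbering_folding_data : folding_data t is_gluing arc_sign.
Proof.
split.
- exact: t_lt.
- exact: t_0.
- exact: t_1.
- exact: is_gluingP.
- have mid : g z0 < (e 0 + e 1) / 2 <= z0.
    by have := e_ltS 0; rewrite add0r -e0E z0E => ?; lra.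
  by rewrite /arc_sign add0r (x_gt0 lm U gam_z0 mid).
- exact: arc_sign_gl.
- by move=> i /arc_sign_ngl[].
Qed.

Let D := numbering_folding_data.

Lemma folding_patternE : folding_pattern a b E = pattern_code is_gluing.
Proof. by []. Qed.

Lemma arcE (i : int) P : Defs.arc gam (E i) (E (i + 1)) P <->
  exists2 u, e i <= u <= e (i + 1) & gam u = P.
Proof.
rewrite /Defs.arc -!eE; split=> [[s [u [v [/gam_inj-> /gam_inj-> <-]]]]|[u ui <-]].
  by rewrite min_l ?max_r ?(ltW (e_ltS i))// => ?; exists v.
exists (e i), (e (i + 1)), u; split=> //.
by rewrite min_l ?max_r ?(ltW (e_ltS i)).
Qed.

Lemma folding_treeE : folding_tree a b gam E = tree_code t.
Proof.
apply/funext => i; apply/funext => j; apply/propext.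
have imE u : (lozi a b @` Defs.arc gam (E i) (E (i + 1))) (gam u) <->
    e (t (i + 1)) <= u <= e (t i).
  rewrite -!tE; split=> [[_ /arcE[v /andP[iv vi] <-]]|/andP[iu ui]].
    by rewrite -(ud_f U) => /gam_inj <-; rewrite !(f_le U).
  exists (gam (g u)); last by rewrite -(ud_f U) gK.
  apply/arcE; exists (g u) => //.
  by rewrite -{1}[e i]fK -(fK (e (i + 1))) !(g_le U) ui.
rewrite /tree_code; split=> [ij|/andP[ij ji] P /arcE[u /andP[ju uj] <-]].
  have e_in k : k = j \/ k = j + 1 -> t (i + 1) <= k <= t i.
    move=> kj; have /ij/imE : Defs.arc gam (E j) (E (j + 1)) (gam (e k)).
      by apply/arcE; exists (e k) => //; rewrite !e_le; lia.
    by rewrite !e_le.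
  by have := e_in j; have := e_in (j + 1); lia.
apply/imE; rewrite (le_trans _ ju) ?e_le// (le_trans uj)// e_le; lia.
Qed.

Lemma arc_sign_x (i : int) : ~ is_gluing i -> x (e i) <> 0 ->
  has_sign (arc_sign i) (x (e i)).
Proof.
move=> /arc_sign_ngl[_ near_i] /eqP; rewrite neq_lt => /orP[xi|xi].
  have [v /andP[v1 _] [vi xv]] := near_right (e_ltS i)
    (filterI near_i (x_near_lt0 U xi)).
  by rewrite (has_sign_inj (vi _) (_ : has_sign Minus (x v))) ?gt_eqF.
have [v /andP[v1 _] [vi xv]] := near_right (e_ltS i)
  (filterI near_i (x_near_gt0 U xi)).
by rewrite (has_sign_inj (vi _) (_ : has_sign Plus (x v))) ?gt_eqF.
Qed.

(** * Kneading sequences of the turning points *)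

Section Kneading.
Context {j : int}.
Hypothesis gj : is_gluing j.
Let sT := e (t j).

Let sTE : sT = f (e j). Proof. by rewrite tE. Qed.

Let code (n : int) := symbol_sign (kneading_code t arc_sign j n).

Lemma param_iter_future (n : nat) : F n sT = e (iter n.+1 t j).
Proof. by rewrite iterSr -iter_te. Qed.

Let F_gluing : F (-1) sT = e j. Proof. by rewrite sTE /= fK. Qed.

(** A gluing point is not the image of a basic point, so its backward orbit runs through the
    interiors of basic arcs, along the chain of parents. *)
Lemma param_iter_past (n : nat) :
  e (iter n.+1 (parent t) j) < iter n.+1 g (e j)
    < e (iter n.+1 (parent t) j + 1).
Proof.
elim: n => [|n IH].
  have /andP[H1 H2] := parentP D j.
  have H1' : t (parent t j + 1) < j.
    by rewrite lt_neqAle H1 andbT; apply/eqP/(is_gluingP j).1.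
  by rewrite /= -(fK (e (parent t j))) -(fK (e (parent t j + 1))) !(g_lt U) !tE
    !e_lt H2.
rewrite [iter n.+2 g _]iterS [iter n.+2 (parent t) j]iterS.
move: IH; set k := iter n.+1 (parent t) j => /andP[ku uk].
have /andP[H1 H2] := parentP D k.
rewrite -(fK (e (parent t k))) -(fK (e (parent t k + 1))) !(g_lt U) !tE.
by rewrite (lt_le_trans uk) ?e_le ?(le_lt_trans _ ku) ?e_le//; lia.
Qed.

Let t_ngl i : ~ is_gluing (t i).
Proof. by move=> /is_gluingP/(_ i). Qed.

Let near_sT (n : nat) :
  \forall u \near sT, u != sT -> has_sign (code n) (x (iter n f u)).
Proof.
have [_ H] := @arc_sign_ngl (iter n.+1 t j) (@t_ngl _).
have f_cont : continuous (iter n f).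
  elim: n {H} => [|n IH] s; first exact: cvg_id.
  by apply: continuous_comp; [exact: IH|exact: f_continuous U _].
have FE : iter n f sT = e (iter n.+1 t j) := param_iter_future n.
rewrite -FE in H; have fH : \forall u \near sT, iter n f u != iter n f sT ->
    has_sign (arc_sign (iter n.+1 t j)) (x (iter n f u)).
  exact: (f_cont sT _ H).
apply: filterS fH => u Hu us; apply: Hu.
apply: contraNneq us => fu.
by apply/eqP; apply: (can_inj (iter_g_f n)).
Qed.

Lemma code_sign (n : int) : n <> -1 ->
  x (F n sT) = 0 /\ 0 <= n \/ has_sign (code n) (x (F n sT)).
Proof.
case: n => [n|[|n]] // _; last first.
  right; rewrite /code /=.
  have -> : g (g (iter n g sT)) = iter n.+1 g (e j).
    by rewrite -[LHS]/(iter n.+2 g sT) iterSr sTE fK.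
  exact: arc_signP (param_iter_past n).
have [xn|/eqP xn] := eqVneq (x (F n sT)) 0; [by left|right].
by move: xn; rewrite param_iter_future; exact: (arc_sign_x (@t_ngl (iter n t j))).
Qed.

Lemma admissibleP r : admissible a b gam (gam sT) r <->
  forall n : int, n <> -1 -> r n = code n.
Proof.
have [xj xj'] := (is_gluingE j).1 gj.
have past_neq0 (k : int) : k < -1 -> x (F k sT) <> 0.
  case: k => [//|[|k]] // _; rewrite /F sTE iterSr fK; exact: (xj' k.+1).
split=> [[rP radm] n n1|rE].
  have [+ +] := rP n; rewrite -(gam_param_iter lm U).
  have [[xn n0] _ _|] := code_sign n1; last first.
    case: (r n); case: (code n) => //= H A B.
      by have := A erefl; rewrite leNgt H.
    by have := B erefl; rewrite leNgt H.
  have : \forall u \near sT^', has_sign (r n) (lozi_iter a b n (gam u)).1.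
    apply: (radm (-1)) => //; rewrite -?(gam_param_iter lm U) ?F_gluing//.
    by move=> k k1; rewrite -(gam_param_iter lm U); exact: past_neq0.
  case: n n0 {n1 xn} => // n _ rn.
  have {}rn : \forall u \near sT, u != sT -> has_sign (r n) (x (iter n f u)).
    by apply: filterS rn => u; rewrite -(gam_param_iter lm U).
  have sT1 : sT < sT + 1 by rewrite ltrDl.
  have [v /andP[v1 _] [vr vc]] := near_right sT1 (filterI rn (near_sT n)).
  have vT : v != sT by rewrite gt_eqF.
  exact: has_sign_inj (vr vT) (vc vT).
split=> [n|k n xk xk' kn xn s /gam_inj ->].
  rewrite -(gam_param_iter lm U); have [->|/eqP n1] := eqVneq n (-1).
    by rewrite F_gluing xj.
  rewrite rE//; have [[-> _]//|] := code_sign n1.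
  by case: (code n) => /= /ltW.
have kE : k = -1.
  have [k1|k1|//] := ltgtP k (-1).
    by case: (past_neq0 k k1); rewrite (gam_param_iter lm U).
  by case: (xk' _ k1); rewrite -(gam_param_iter lm U) F_gluing.
rewrite kE in kn; rewrite rE; last by lia.
case: n kn xn => [n|n] kn _; last by lia.
have := near_sT n; apply: filterS => u Hu us.
by rewrite -(gam_param_iter lm U); exact: Hu.
Qed.

Lemma kneading_ofP kn : kneading_of a b gam (gam sT) kn <->
  kn = kneading_code t arc_sign j.
Proof.
have codeE (n : int) : n <> -1 -> kneading_code t arc_sign j n = Only (code n).
  by case: n => [n|[|n]].
split=> [[p [q [pqP [p1 q1] knE kn1]]]|->].
  apply/funext => n; have [->//|/eqP n1] := eqVneq n (-1).
  have /admissibleP pE : admissible a b gam (gam sT) p by apply/pqP; left.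
  by have [_ ->] := knE n n1; rewrite codeE// pE.
exists code, (fun n => if n == -1 then Minus else code n); split=> //.
- move=> r; split=> [/admissibleP rE|[]->]; last 2 first.
  + exact/admissibleP.
  + by apply/admissibleP => n /eqP/negbTE ->.
  case r1 : (r (-1)); [left|right]; apply/funext => n.
    by have [->|/eqP/rE] := eqVneq n (-1).
  by have [->|/eqP/rE] := eqVneq n (-1).
- by move=> n n1; rewrite codeE// (negbTE (introN eqP n1)).
Qed.

Lemma itinerary_codeP m' : itinerary a b (gam (e (iter m' t j)))
  (itinerary_code t arc_sign j m').
Proof.
have /admissibleP[codeP _] : forall n : int, n <> -1 -> code n = code n by [].
move=> n; have [] := codeP (n + m'%:Z - 1).
suff -> : lozi_iter a b (n + m'%:Z - 1) (gam sT) =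
    lozi_iter a b n (gam (e (iter m' t j))) by [].
rewrite -!(gam_param_iter lm U) -addrA -(param_iterD U); congr (gam (F _ _)).
by rewrite (param_iterP U) param_iter_future -(fK (e (iter m' t j))) tE.
Qed.

End Kneading.

Lemma kneading_setE :
  kneading_set a b gam = kneading_codes t is_gluing arc_sign.
Proof.
have TE j : gam (e (t j)) = L (E j) by rewrite -tE (ud_f U) eE.
apply/seteqP; split=> kn.
  move=> [T [G gG ->]]; have [_ _ _] := EN.
  have : basic a b G by exact: Or31.
  have [<- _ _] := EN => -[j _ jE]; rewrite -jE in gG *.
  by rewrite -TE => /(kneading_ofP gG) ->; exists j.
move=> [j gj ->]; exists (L (E j)); first by exists (E j).
by rewrite -TE; apply/(kneading_ofP gj).
Qed.

(** For [ko_0]: two distinct gluing points with the same past would differ by a cone vector, hence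
    in abscissa, but both lie on the axis. *)
Lemma numbering_kneading_order : kneading_order t is_gluing arc_sign.
Proof.
split=> [i j m' n gi gj|i gi iPlus].
  rewrite -e_lt => ij; split.
    exact: (itinerary_inj lm U gam_z0 ij (itinerary_codeP gi m')
      (itinerary_codeP gj n)).
  exact: (itin_lt_param lm U gam_z0 ij (itinerary_codeP gi m')
    (itinerary_codeP gj n)).
have g0 := fd_gl0 D; have [xi _] := (is_gluingE i).1 gi.
have [x0 _] := (is_gluingE 0).1 g0.
have past (n : int) : n < 0 ->
    itinerary_code t arc_sign i 0 n = itinerary_code t arc_sign 0 0 n.
  by move=> n0; rewrite /itinerary_code iPlus ?(kneading_code0 D)//; lia.
have itP k (gk : is_gluing k) := itinerary_codeP gk 0.
have [i0|i0|//] := ltgtP i 0; rewrite -e_lt in i0.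
  have [c /in_cone_neq] := shared_past lm U gam_z0 i0 (itP _ gi) (itP _ g0) past.
  by rewrite /= xi x0.
have past' (n : int) : n < 0 ->
    itinerary_code t arc_sign 0 0 n = itinerary_code t arc_sign i 0 n.
  by move=> /past ->.
have [c /in_cone_neq] := shared_past lm U gam_z0 i0 (itP _ g0) (itP _ gi) past'.
by rewrite /= xi x0.
Qed.

End Numbering.

Lemma system_code (R : realType) (a b : R) (gam : R -> R * R)
    (E : int -> R * R) :
  param_region a b -> unstable_param a b gam -> basic_numbering a b gam E ->
  exists t gl sg,
  [/\ folding_data t gl sg, kneading_order t gl sg,
      kneading_set a b gam = kneading_codes t gl sg,
      folding_pattern a b E = pattern_code gl
    & folding_tree a b gam E = tree_code t].
Proof.
move=> /param_region_eigen[l [m [-> -> m0 l1 [l2 lm_lt ZE]]]] UP EN.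
have lm : eigen_params l m by [].
have [f [g U]] := unstable_dynamics_ex (lm_neq0 lm) UP.
have gamR P : unstable (l - m) (l * m) P -> exists s, gam s = P.
  by have [_ <- _ _ _] := UP => -[s _ <-]; exists s.
have ex_e i : exists s, gam s = E i.
  apply: gamR; have : basic (l - m) (l * m) (E i).
    by have [<- _ _] := EN; exists i.
  move=> /basicP[G [uG _ _] [n ->]]; elim: n => // n IH.
  by apply/unstable_lozi_inv; rewrite iterS loziK ?lm_neq0.
have [e eE] := choice ex_e.
have ex_t i : exists j, f (e i) = e j.
  apply: (e_basic U EN eE); rewrite (ud_f U) eE.
  have /basicP[G gG [n ->]] : basic (l - m) (l * m) (E i).
    by have [<- _ _] := EN; exists i.
  by apply/basicP; exists G => //; exists n.+1.
have [t tE] := choice ex_t.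
exists t, (@is_gluing R l m E), (@arc_sign R gam e); split.
- exact: numbering_folding_data lm U EN ZE eE tE.
- exact: numbering_kneading_order lm U EN ZE eE tE.
- exact: kneading_setE lm U EN ZE eE tE.
- exact: folding_patternE.
- exact: folding_treeE U EN eE tE.
Qed.

(** * Recovery of the three objects from each other *)

Lemma same_plane_tree_refl g : same_plane_tree g g.
Proof. by exists id; split=> //; exists id. Qed.

Lemma same_plane_tree_sym g g' : same_plane_tree g g' -> same_plane_tree g' g.
Proof.
move=> [phi [[psi phiK psiK] phiE phiL phi_lt]]; exists psi.
have psiL n i : at_level g' n i <-> at_level g n (psi i).
  by rewrite -{1}(psiK i); split=> /phiL.
split=> //; first by exists phi.
- by move=> i j; rewrite -{1}(psiK i) -{1}(psiK j); split=> /phiE.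
- by move=> n i j /psiL ni /psiL nj; rewrite (phi_lt _ _ _ ni nj) !psiK.
Qed.

Lemma same_plane_tree_trans g1 g2 g3 : same_plane_tree g1 g2 ->
  same_plane_tree g2 g3 -> same_plane_tree g1 g3.
Proof.
move=> [phi [phi_bij phiE phiL phi_lt]] [psi [psi_bij psiE psiL psi_lt]].
exists (psi \o phi); split.
- exact: bij_comp.
- by move=> i j; split=> [/phiE/psiE|/psiE/phiE].
- by move=> n i; split=> [/phiL/psiL|/psiL/phiL].
- move=> n i j ni nj; rewrite (phi_lt n)// (psi_lt n)//; exact/phiL.
Qed.

Lemma factor_through (I A B : Type) (rel : A -> A -> Prop) (u : I -> A)
    (v : I -> B) (dflt : B) :
  (forall x, rel x x) -> (forall x y, rel x y -> rel y x) ->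
  (forall x y w, rel x y -> rel y w -> rel x w) ->
  (forall c d, rel (u c) (u d) -> v c = v d) ->
  exists h : A -> B, (forall x y, rel x y -> h x = h y) /\
    forall c, h (u c) = v c.
Proof.
move=> rel_refl rel_sym rel_trans uv.
pose S x : set B := [set w | exists2 c, rel (u c) x & v c = w].
(* The choice depends on the set of candidates only, so related arguments, having equal sets, get
   equal values. *)
pose pick (T : set B) : B :=
  if pselect (exists w, T w) is left ex then sval (cid ex) else dflt.
exists (fun x => pick (S x)); split=> [x y xy|c].
  suff -> : S x = S y by [].
  apply/seteqP; split=> w [c uc <-]; exists c => //.
    exact: rel_trans uc xy.
  exact: rel_trans uc (rel_sym _ _ xy).
rewrite /pick; case: pselect => [ex|[]]; last by exists (v c), c.
by case: (cid ex) => w /= [d /uv vd <-].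
Qed.

Theorem theorem8 (R : realType) :
  exists (pattern_of_kneading : set (int -> ksymbol) -> (int -> fsymbol))
         (tree_of_kneading : set (int -> ksymbol) -> digraph)
         (kneading_of_pattern : (int -> fsymbol) -> set (int -> ksymbol))
         (tree_of_pattern : (int -> fsymbol) -> digraph)
         (kneading_of_tree : digraph -> set (int -> ksymbol))
         (pattern_of_tree : digraph -> (int -> fsymbol)),
    (* recovery from the tree uses only the embedded tree, not the labels *)
    (forall g g' : digraph, same_plane_tree g g' ->
       kneading_of_tree g = kneading_of_tree g' /\
       pattern_of_tree g = pattern_of_tree g') /\
    forall (a b : R) (gam : R -> R * R) (E : int -> R * R),
      param_region a b ->
      unstable_param a b gam ->
      basic_numbering a b gam E ->
      let K := kneading_set a b gam in
      let F := folding_pattern a b E in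
      let T := folding_tree a b gam E in
      [/\ pattern_of_kneading K = F /\ tree_of_kneading K = T,
          kneading_of_pattern F = K /\ tree_of_pattern F = T
        & kneading_of_tree T = K /\ pattern_of_tree T = F].
Proof.
(* Abstract systems do not mention [a], [b] or [gam], so the recovery functions serve all parameters
   at once. *)
pose system := {c : (int -> int) * (int -> Prop) * (int -> sign) |
  folding_data c.1.1 c.1.2 c.2 /\ kneading_order c.1.1 c.1.2 c.2}.
pose Ks (c : system) := kneading_codes (sval c).1.1 (sval c).1.2 (sval c).2.
pose Fs (c : system) := pattern_code (sval c).1.2.
pose Ts (c : system) := tree_code (sval c).1.1.
have eq_gl (c d : system) : (sval c).1.2 = (sval d).1.2 ->
    [/\ Ks c = Ks d, Fs c = Fs d & Ts c = Ts d].
  rewrite /Ks /Fs /Ts; case: c d => -[[t gl] sg] [/= D _] [[[t' gl'] sg'] [/= D' _]].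
  by move=> glE; rewrite -glE in D' *; have [-> ->] := folding_data_eq D D'.
have eq_F (c d : system) : Fs c = Fs d -> [/\ Ks c = Ks d, Fs c = Fs d & Ts c = Ts d].
  by move=> /pattern_code_inj; exact: eq_gl.
have eq_K (c d : system) : Ks c = Ks d -> [/\ Ks c = Ks d, Fs c = Fs d & Ts c = Ts d].
  move=> KE; apply: eq_gl; move: KE; rewrite /Ks.
  case: c d => -[[t gl] sg] [/= D O] [[[t' gl'] sg'] [/= D' O']] KE.
  apply/funext => i; apply/propext; split.
    exact: kneading_codes_gl D D' O O' KE _.
  exact: kneading_codes_gl D' D O' O (esym KE) _.
have eq_T (c d : system) : same_plane_tree (Ts c) (Ts d) ->
    [/\ Ks c = Ks d, Fs c = Fs d & Ts c = Ts d].
  move=> TE; apply: eq_gl; move: TE; rewrite /Ts.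
  case: c d => -[[t gl] sg] [/= D O] [[[t' gl'] sg'] [/= D' O']].
  move=> /(same_plane_tree_code D D') tE; rewrite -tE in D'.
  apply/funext => i; apply/propext.
  by split=> [/(fd_gl D)/(fd_gl D')|/(fd_gl D')/(fd_gl D)].
have eq_trans (A : Type) (x y w : A) : x = y -> y = w -> x = w by move=> ->.
have [pk [_ pkE]] := @factor_through _ _ _ eq Ks Fs (fun=> FX)
  (@erefl _) (@esym _) (@eq_trans _)
  (fun c d h => let: And3 _ H _ := eq_K c d h in H).
have [tk [_ tkE]] := @factor_through _ _ _ eq Ks Ts (fun _ _ => True)
  (@erefl _) (@esym _) (@eq_trans _)
  (fun c d h => let: And3 _ _ H := eq_K c d h in H).
have [kp [_ kpE]] := @factor_through _ _ _ eq Fs Ks set0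
  (@erefl _) (@esym _) (@eq_trans _)
  (fun c d h => let: And3 H _ _ := eq_F c d h in H).
have [tp [_ tpE]] := @factor_through _ _ _ eq Fs Ts (fun _ _ => True)
  (@erefl _) (@esym _) (@eq_trans _)
  (fun c d h => let: And3 _ _ H := eq_F c d h in H).
have [kt [kt_rel ktE]] := @factor_through _ _ _ same_plane_tree Ts Ks set0
  same_plane_tree_refl same_plane_tree_sym same_plane_tree_trans
  (fun c d h => let: And3 H _ _ := eq_T c d h in H).
have [pt [pt_rel ptE]] := @factor_through _ _ _ same_plane_tree Ts Fs (fun=> FX)
  same_plane_tree_refl same_plane_tree_sym same_plane_tree_trans
  (fun c d h => let: And3 _ H _ := eq_T c d h in H).
exists pk, tk, kp, tp, kt, pt; split=> [g g' gg'|a b gam E Rab Ugam EN /=].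
  by rewrite (kt_rel _ _ gg') (pt_rel _ _ gg').
have [t [gl [sg [D O -> -> ->]]]] := system_code Rab Ugam EN.
pose c : system := exist _ (t, gl, sg) (conj D O).
split; split; first [exact: (pkE c)|exact: (tkE c)|exact: (kpE c)|
  exact: (tpE c)|exact: (ktE c)|exact: (ptE c)].
Qed.
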